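(* Let $V$ be a simple $n$-dimensional Euclidean Jordan algebra with unit $e$, cone of squares $K$ and rank $r>1$. Let $x\in K^\circ$, let $\lambda_1,\dots,\lambda_r$ be the eigenvalues of $x$ counted with multiplicity (i.e. $x=\lambda_1c_1+\cdots+\lambda_rc_r$ for a Jordan frame $c_1,\dots,c_r$), and let $k$ be the number of indices $i\in\{1,\dots,r\}$ such that $\max\{\lambda_i,\lambda_i^{-1}\}\neq\max\{\lambda_+(x),\lambda_-(x)^{-1}\}$. Then the dimension of the affine span of the midpoints set $\mathcal{M}(x,e)$ satisfies \[ \dim\mathrm{aff}(\mathcal{M}(x,e))=k+\frac{n-r}{r(r-1)}\,k(k-1). \]
   Context: A Euclidean Jordan algebra is a finite-dimensional real inner-product space $(V,\langle\cdot,\cdot\rangle)$ with a bilinear product $\bullet$ such that for all $x,y,z\in V$: $x\bullet y=y\bullet x$; $x\bullet(x^2\bullet y)=x^2\bullet(x\bullet y)$; and $\langle L(x)y,z\rangle=\langle y,L(x)z\rangle$, where $L(x)y:=x\bullet y$. Its unit is $e$. It is simple if it has no non-trivial ideals. The cone of squares is $K=\{x^2:x\in V\}$, with interior $K^\circ$. An idempotent is $c$ with $c^2=c$; a nonzero idempotent is primitive if it is not a sum of two nonzero orthogonal idempotents (idempotents $c,c'$ are orthogonal if $c\bullet c'=0$). A Jordan frame is a set $\{c_1,\dots,c_r\}$ of pairwise orthogonal primitive idempotents with $c_1+\dots+c_r=e$; all Jordan frames have the same number $r=\mathrm{rank}(V)$ of elements. Every $x\in V$ can be written as $x=\lambda_1c_1+\dots+\lambda_rc_r$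 for some Jordan frame, the real numbers $\lambda_i$ (with multiplicities) being uniquely determined by $x$; these are the eigenvalues of $x$, $\lambda_+(x)$ is the largest and $\lambda_-(x)$ the smallest. Write $a\le_K b$ if $b-a\in K$. For $x,y\in K^\circ$ let $M(x/y):=\inf\{\beta>0:x\le_K\beta y\}$; Thompson's metric on $K^\circ$ is $d_T(x,y):=\log\max\{M(x/y),M(y/x)\}$, and $\mathcal{M}(x,y):=\{z\in K^\circ:d_T(x,z)=\tfrac12d_T(x,y)=d_T(z,y)\}$. $\mathrm{aff}$ denotes affine span. *)

(* Defs.v *)
From HB Require Import structures.
From mathcomp Require Import all_boot all_order all_algebra.
From mathcomp Require Import boolp classical_sets reals exp.

Set Implicit Arguments.
Unset Strict Implicit.
Unset Printing Implicit Defensive.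

Import Order.TTheory GRing.Theory Num.Theory.

Local Open Scope classical_set_scope.
Local Open Scope ring_scope.

(* The inner product is [jdot]: a positive definite symmetric bilinear form.  *)
(* The unit is not part of the structure: it is a vector [e] satisfying       *)
(* [is_unit A e].                                                             *)
Record euclideanJordanAlgebra (R : realType) (V : vectType R) :=
  EuclideanJordanAlgebra {
    jmul : {bilinear V -> V -> V};
    jdot : {dot V for idfun};
    jmulC : forall x y, jmul x y = jmul y x;
    jmul_jordan : forall x y,
      jmul x (jmul (jmul x x) y) = jmul (jmul x x) (jmul x y);
    jdot_jmul : forall x y z, jdot (jmul x y) z = jdot y (jmul x z)
  }.

Section EuclideanJordanAlgebra.
Context (R : realType) (V : vectType R) (A : euclideanJordanAlgebra V).

Local Notation "x • y" := (jmul A x y) (at level 40, left associativity).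

Definition is_unit (e : V) : Prop := forall x, e • x = x /\ x • e = x.

Definition is_ideal (I : {vspace V}) : Prop :=
  forall x y, y \in I -> x • y \in I.

Definition is_simple : Prop :=
  forall I : {vspace V}, is_ideal I -> I = 0%VS \/ I = fullv.

Definition cone_of_squares : set V := [set y | exists x : V, y = x • x].

(* A [vectType] carries no topology in the library, so the interior is        *)
(* written with the open balls of the norm |v| = sqrt <v, v>.                 *)
Definition jnorm (v : V) : R := Num.sqrt (jdot A v v).

Definition jinterior (S : set V) : set V :=
  [set x | exists2 eps : R, 0 < eps & forall y, jnorm (y - x) < eps -> S y].

Definition open_cone : set V := jinterior cone_of_squares.

Definition le_K (a b : V) : Prop := cone_of_squares (b - a).

Definition idempotent_elt (c : V) : Prop := c • c = c.

Definition primitive_idempotent (c : V) : Prop :=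
  [/\ idempotent_elt c, c != 0 &
      ~ exists c1 c2 : V,
          [/\ idempotent_elt c1 /\ c1 != 0, idempotent_elt c2 /\ c2 != 0,
              c1 • c2 = 0 & c = c1 + c2]].

(* A frame with [r] elements is enumerated by 'I_r; such an enumeration is    *)
(* injective since the [c i] are nonzero and pairwise orthogonal.             *)
Definition jordan_frame (e : V) (r : nat) (c : 'I_r -> V) : Prop :=
  [/\ forall i, primitive_idempotent (c i),
      forall i j, i != j -> c i • c j = 0 &
      \sum_(i < r) c i = e].

(* All Jordan frames have the same number of elements, so that at most one    *)
(* [r] satisfies this.                                                        *)
Definition has_rank (e : V) (r : nat) : Prop :=
  exists c : 'I_r -> V, jordan_frame e c.

(* [lam] lists the eigenvalues of [x], with multiplicities.                   *)
Definition eigenvalues (e x : V) (r : nat) (lam : 'I_r -> R) : Prop :=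
  exists2 c : 'I_r -> V, jordan_frame e c & x = \sum_(i < r) lam i *: c i.

Definition spectrum (e x : V) : set R :=
  [set a | exists r (lam : 'I_r -> R),
             eigenvalues e x lam /\ exists i, a = lam i].

(* The spectrum is finite, and nonempty when V <> 0: [sup] and [inf] are      *)
(* attained.                                                                  *)
Definition lambda_max (e x : V) : R := sup (spectrum e x).
Definition lambda_min (e x : V) : R := inf (spectrum e x).

Definition gauge (x y : V) : R := inf [set b : R | 0 < b /\ le_K x (b *: y)].

Definition thompson (x y : V) : R := ln (Num.max (gauge x y) (gauge y x)).

Definition midpoints (x y : V) : set V :=
  [set z | [/\ open_cone z, thompson x z = thompson x y / 2 &
               thompson z y = thompson x y / 2]].

End EuclideanJordanAlgebra.

Section Affine.
Context (R : realType) (V : vectType R).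

Definition affine_span (S : set V) : set V :=
  [set z | exists m (p : 'I_m -> V) (t : 'I_m -> R),
     [/\ forall i, S (p i), \sum_(i < m) t i = 1 &
         z = \sum_(i < m) t i *: p i]].

(* [S] is a translate of a [d]-dimensional linear subspace; in particular [S] *)
(* is nonempty, and [d] is determined by [S].                                 *)
Definition has_affine_dim (S : set V) (d : nat) : Prop :=
  exists (z : V) (U : {vspace V}), S = [set y | y - z \in U] /\ \dim U = d.

End Affine.

(* Main.v *)
Require Import Defs.
From HB Require Import structures.
From mathcomp Require Import all_boot all_order all_algebra.
From mathcomp Require Import boolp classical_sets reals exp.
From mathcomp Require Import zify ring lra complex.

(** Write [c_1, ..., c_r] for the Jordan frame of [x], [m] for the number
    [max (lambda_max, 1 / lambda_min)], so that the Thompson distance of [x]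
    and [e] is [ln m], and [s = sqrt m]. By the triangle inequality a point [z]
    is a midpoint as soon as both of its distances are at most [ln s], that is,
    as soon as [x / s <= z <= s x] and [e / s <= z <= s e] ([midpointsP]).

    One solution is [z0], the sum of the [sqrt lambda_i c_i]. For an index [i]
    outside the set [J] of the indices counted by [k], the lower and the upper
    bound have the same inner product with [c_i]; since an element of the cone
    that is orthogonal to an idempotent is annihilated by it, every midpoint [z]
    has [c_i • (z - z0) = 0] for such [i], that is, [z - z0] lies in the Peirce
    space [V_1(c_J)] of [c_J], the sum of the [c_i] with [i] in [J]. For [i] in
    [J] the bounds are strict, so every direction of [V_1(c_J)] may be followed
    from [z0] for a while. Hence the affine span is [z0 + V_1(c_J)]
    ([affine_span_midpoints]).

    It remains to compute the dimension. The space [V_1(c_J)] is the direct sum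
    of the Peirce spaces [V_ij] with [i <= j] in [J]. The diagonal ones are
    lines because the [c_i] are primitive. The other ones have a common
    dimension [D] because the algebra is simple: multiplication by a nonzero
    element of [V_ij] embeds [V_ik] in [V_jk], and if some [V_ij] vanished, the
    indices linked to [i] would span a proper ideal. So the dimension is
    [k + D k (k - 1) / 2]; when [J] is the set of all indices this reads
    [n = r + D r (r - 1) / 2], which determines [D] ([dim_peirce1_part]).

    Two tools carry the argument. The spectral decomposition
    ([spectral_decomposition]), inside any subalgebra, comes from diagonalizing
    the multiplication by [x] on a space of elements that behave like powers of
    [x]. It gives the selfduality of the cone ([coneP]), by which every order
    relation becomes a family of linear inequalities [0 <= <y, q • q>]. *)

Set Implicit Arguments.
Unset Strict Implicit.
Unset Printing Implicit Defensive.

Import Order.TTheory GRing.Theory Num.Theory.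

Local Open Scope ring_scope.

(** * Selfadjoint operators on a Euclidean space *)

Section InnerProduct.
Context (R : realType) (V : vectType R) (f : {dot V for idfun}).

Local Notation "'[ u , v ]" := (f u v) : ring_scope.
Implicit Types (u v w x : V) (U : {vspace V}).

Lemma dotC u v : '[u, v] = '[v, u].
Proof. by rewrite hermC expr0 mul1r. Qed.

Lemma dotDl u v w : '[u + v, w] = '[u, w] + '[v, w].
Proof. exact: linearDl. Qed.

Lemma dotDr u v w : '[u, v + w] = '[u, v] + '[u, w].
Proof. exact: linearDr. Qed.

Lemma dotZl a u v : '[a *: u, v] = a * '[u, v].
Proof. exact: linearZl_LR. Qed.

Lemma dotZr a u v : '[u, a *: v] = a * '[u, v].
Proof. by rewrite dotC dotZl dotC. Qed.

Lemma dotNl u v : '[- u, v] = - '[u, v].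
Proof. exact: linearNl. Qed.

Lemma dotNr u v : '[u, - v] = - '[u, v].
Proof. exact: linearNr. Qed.

Lemma dot0l u : '[0, u] = 0.
Proof. exact: linear0l. Qed.

Lemma dot0r u : '[u, 0] = 0.
Proof. exact: linear0r. Qed.

Definition dotE := (dotDl, dotDr, dotNl, dotNr, dotZl, dotZr, dot0l, dot0r).

Lemma dot_suml (I : Type) (r : seq I) (P : pred I) (F : I -> V) v :
  '[\sum_(i <- r | P i) F i, v] = \sum_(i <- r | P i) '[F i, v].
Proof. exact: linear_sumlz. Qed.

Lemma dot_gt0 u : u != 0 -> 0 < '[u, u].
Proof. exact: neq0_dnorm_gt0. Qed.

Lemma dot_ge0 u : 0 <= '[u, u].
Proof. by have [->|/dot_gt0/ltW//] := eqVneq u 0; rewrite dot0l. Qed.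

Lemma dot_eq0 u : '[u, u] = 0 -> u = 0.
Proof.
by move=> h; apply/eqP/negPn/negP => /dot_gt0; rewrite h ltxx.
Qed.

Lemma dot_inj u v : (forall w, '[u, w] = '[v, w]) -> u = v.
Proof.
by move=> h; apply/eqP; rewrite -subr_eq0; apply/eqP/dot_eq0; rewrite dotDl h dotNl subrr.
Qed.

Lemma cauchy_schwarz u v : '[u, v] ^+ 2 <= '[u, u] * '[v, v].
Proof.
have [->|v0] := eqVneq v 0; first by rewrite !dot0r expr0n mulr0.
have vp := dot_gt0 v0.
have := dot_ge0 ('[v, v] *: u - '[u, v] *: v).
rewrite !dotE (dotC v u) => h.
have : 0 <= '[v, v] * ('[u, u] * '[v, v] - '[u, v] ^+ 2) by lra.
by rewrite pmulr_rge0 // subr_ge0.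
Qed.

(** A selfadjoint operator has no eigenvalue [a + b 'i] with [b != 0]: if
    [u + v 'i] is an eigenvector, comparing [<T u, v>] and [<u, T v>] gives
    [b (|u|^2 + |v|^2) = 0]. Since the complex numbers are algebraically
    closed, an eigenvector over them always exists. *)
Lemma selfadjoint_eigenvector (T : 'End(V)) U :
  (forall u v, '[T u, v] = '[u, T v]) -> (forall u, u \in U -> T u \in U) ->
  U != 0%VS -> exists a u, [/\ u \in U, u != 0 & T u = a *: u].
Proof.
move=> Tsym TU U0; set b := vbasis U.
pose vec (v : 'rV[R]_(\dim U)) : V := \sum_i v 0 i *: b`_i.
pose M : 'M[R]_(\dim U) := \matrix_(i, j) coord b j (T b`_i).
have Tvec (v : 'rV_(\dim U)) : T (vec v) = vec (v *m M).
  rewrite linear_sum /=.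
  under eq_bigr => i _.
    rewrite linearZ /= (coord_vbasis (TU _ (vbasis_mem (mem_nth 0 _)))) ?size_tuple //.
    rewrite scaler_sumr.
    over.
  rewrite exchange_big /=; apply: eq_bigr => j _.
  rewrite mxE scaler_suml; apply: eq_bigr => i _.
  by rewrite mxE scalerA.
have vecU (v : 'rV_(\dim U)) : vec v \in U.
  by apply: memv_suml => i _; apply/memvZ/vbasis_mem/mem_nth; rewrite size_tuple.
have vec_inj (v : 'rV_(\dim U)) : vec v = 0 -> v = 0.
  move=> h; apply/rowP => i; rewrite mxE.
  have /freeP : free b by exact: basis_free (vbasisP U).
  by move=> /(_ (fun i => v 0 i) h i).
have vecD (v w : 'rV_(\dim U)) : vec (v + w) = vec v + vec w.
  by rewrite -big_split; apply: eq_bigr => i _; rewrite mxE scalerDl.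
have vecZ a (v : 'rV_(\dim U)) : vec (a *: v) = a *: vec v.
  by rewrite scaler_sumr; apply: eq_bigr => i _; rewrite mxE scalerA.
have dU : (0 < \dim U)%N by rewrite lt0n dimv_eq0.
have [[a c] /eigenvalueP[z zM z0]] :=
  eigenvalue_closed (map_mx (real_complex R) M) dU.
pose p := map_mx (@complex.Re R) z; pose q := map_mx (@complex.Im R) z.
have ReD (s t : R[i]) : complex.Re (s + t) = complex.Re s + complex.Re t by case: s; case: t.
have ImD (s t : R[i]) : complex.Im (s + t) = complex.Im s + complex.Im t by case: s; case: t.
have pM : p *m M = a *: p - c *: q.
  apply/rowP => j; move/rowP/(_ j): zM; rewrite !mxE => /(congr1 (@complex.Re R)).
  rewrite (big_morph (@complex.Re R) ReD (erefl _)) => h.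
  transitivity (complex.Re ((a +i* c)%C * z 0 j)); last by case: (z 0 j).
  rewrite -h; apply: eq_bigr => i _; rewrite !mxE.
  by case: (z 0 i) => s t /=; rewrite mulr0 subr0.
have qM : q *m M = c *: p + a *: q.
  apply/rowP => j; move/rowP/(_ j): zM; rewrite !mxE => /(congr1 (@complex.Im R)).
  rewrite (big_morph (@complex.Im R) ImD (erefl _)) => h.
  transitivity (complex.Im ((a +i* c)%C * z 0 j)); last by case: (z 0 j) => s t /=; rewrite addrC.
  rewrite -h; apply: eq_bigr => i _; rewrite !mxE.
  by case: (z 0 i) => s t /=; rewrite mulr0 add0r.
have Tp : T (vec p) = a *: vec p - c *: vec q.
  by rewrite Tvec pM vecD -scaleN1r !vecZ scaleN1r.
have Tq : T (vec q) = c *: vec p + a *: vec q by rewrite Tvec qM vecD !vecZ.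
have pq0 : (vec p != 0) || (vec q != 0).
  apply: contraNT z0; rewrite negb_or !negbK => /andP[/eqP/vec_inj p0 /eqP/vec_inj q0].
  apply/eqP/rowP => i; rewrite mxE.
  move/rowP/(_ i): p0; move/rowP/(_ i): q0; rewrite !mxE.
  by case: (z 0 i) => s t /= -> ->.
have c0 : c = 0.
  have := Tsym (vec p) (vec q); rewrite Tp Tq !dotE => h.
  have {h} /eqP : c * ('[vec p, vec p] + '[vec q, vec q]) = 0 by lra.
  rewrite mulf_eq0 => /orP[/eqP//|].
  rewrite paddr_eq0 ?dot_ge0 // => /andP[/eqP/dot_eq0 hp /eqP/dot_eq0 hq].
  by rewrite hp hq eqxx in pq0.
move: Tp Tq; rewrite c0 !scale0r subr0 add0r => Tp Tq.
case/orP: pq0 => n0.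
  by exists a, (vec p); split.
by exists a, (vec q); split.
Qed.

(** Induction on [\dim U]: for an eigenvalue [a] of [T] on [U], the image
    [(T - a) U] is stable under [T] and meets the eigenspace of [a] only in
    [0], since [(T - a)^2 u = 0] forces [|(T - a) u|^2 = 0]; so [U] is the sum
    of the two. *)
Lemma selfadjoint_decomposition (T : 'End(V)) U x :
  (forall u v, '[T u, v] = '[u, T v]) -> (forall u, u \in U -> T u \in U) ->
  x \in U ->
  exists s : seq (R * V),
    [/\ uniq (map fst s), x = \sum_(p <- s) p.2 &
        forall p, p \in s -> [/\ p.2 \in U, p.2 != 0 & T p.2 = p.1 *: p.2]].
Proof.
move=> Tsym; have [m] := ubnP (\dim U); elim: m U x => // m IHm U x ltUm TU xU.
have [U0|U0] := eqVneq U 0%VS.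
  exists [::]; split => //; rewrite big_nil; apply/eqP.
  by rewrite -memv0 -U0.
have [a [u [uU u0 Tu]]] := selfadjoint_eigenvector Tsym TU U0.
pose S := T - a *: \1%VF.
have SE v : S v = T v - a *: v.
  by rewrite add_lfunE opp_lfunE scale_lfunE id_lfunE.
have Ssym v w : '[S v, w] = '[v, S w] by rewrite !SE !dotE Tsym.
have STC v : T (S v) = S (T v) by rewrite !SE linearB linearZ.
have Ecap : (U :&: lker S :&: (S @: U) = 0)%VS.
  apply/eqP; rewrite -subv0; apply/subvP => v; rewrite memv_cap memv0.
  case/andP; rewrite memv_cap memv_ker => /andP[_ /eqP Sv0] /memv_imgP[w wU vE].
  by apply/eqP/dot_eq0; rewrite {1}vE Ssym Sv0 dot0r.
have SU : (S @: U <= U)%VS.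
  apply/subvP => v /memv_imgP[w wU ->]; rewrite SE.
  by apply: memvB; [exact: TU|exact: memvZ].
have UE : (U = U :&: lker S + S @: U)%VS.
  apply/esym/eqP; rewrite eqEdim; apply/andP; split.
    by rewrite subv_add capvSl SU.
  by rewrite dimv_disjoint_sum // limg_ker_dim.
have : x \in (U :&: lker S + S @: U)%VS by rewrite -UE.
case/memv_addP => y; rewrite memv_cap memv_ker SE subr_eq0.
move=> /andP[yU /eqP Ty] [z zSU xE].
have ltS : (\dim (S @: U) < m)%N.
  rewrite -ltnS; apply: leq_trans ltUm; rewrite ltnS -(limg_ker_dim S U).
  rewrite -addn1 addnC leq_add2r lt0n dimv_eq0; apply: contraNneq u0 => h.
  by rewrite -memv0 -h memv_cap uU memv_ker SE Tu subrr eqxx.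
have TS v : v \in (S @: U)%VS -> T v \in (S @: U)%VS.
  by move=> /memv_imgP[w wU ->]; rewrite STC memv_img ?TU.
have [s [us zE sP]] := IHm _ _ ltS TS zSU.
have aNs : a \notin map fst s.
  apply/mapP => -[p /sP[pS p0 Tp] ap]; case/negP: p0.
  rewrite -memv0 -Ecap !memv_cap pS memv_ker SE Tp -ap subrr eqxx !andbT.
  by apply: (subvP SU).
have sPU p : p \in s -> [/\ p.2 \in U, p.2 != 0 & T p.2 = p.1 *: p.2].
  by move=> /sP[pS p0 Tp]; split=> //; apply: (subvP SU).
have [y0|y0] := eqVneq y 0; first by exists s; rewrite xE y0 add0r.
exists ((a, y) :: s); split => /=; first by rewrite aNs us.
  by rewrite big_cons xE zE.
by move=> p; rewrite inE => /orP[/eqP->|/sPU].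
Qed.

(** Gram-Schmidt: the vectors of [U] orthogonal to a unit vector of [U] form a
    space of smaller dimension. *)
Lemma orthonormal_expansion U :
  exists s : seq V,
    [/\ forall b, b \in s -> b \in U, forall b, b \in s -> '[b, b] = 1 &
        forall v, v \in U -> v = \sum_(b <- s) '[v, b] *: b].
Proof.
have [m] := ubnP (\dim U); elim: m U => // m IHm U ltUm.
have [->|U0] := eqVneq U 0%VS.
  by exists [::]; split=> // v; rewrite memv0 => /eqP->; rewrite big_nil.
pose w := vpick U; have w0 : w != 0 by rewrite vpick0.
have ww := dot_gt0 w0.
pose u := (Num.sqrt '[w, w])^-1 *: w.
have uU : u \in U by rewrite memvZ ?memv_pick.
have uu : '[u, u] = 1.
  have := sqr_sqrtr (ltW ww); move: (ww); rewrite -sqrtr_gt0 /u.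
  move: (Num.sqrt _) => t t0 tt; rewrite !dotE -tt.
  by field; rewrite gt_eqF.
pose F := (U :&: lker (linfun (f u : V -> R^o)))%VS.
have memF v : (v \in F) = (v \in U) && ('[u, v] == 0).
  by rewrite memv_cap memv_ker lfunE.
have ltF : (\dim F < m)%N.
  rewrite -ltnS; apply: leq_trans ltUm; rewrite ltnS.
  rewrite (ltn_leqif (dimv_leqif_sup (capvSl _ _))).
  apply/subvPn; exists u => //; rewrite memF uU uu /=.
  by rewrite oner_eq0.
have [s [sF s1 sE]] := IHm _ ltF.
exists (u :: s); split.
- by move=> b; rewrite inE => /orP[/eqP->//|/sF]; rewrite memF => /andP[].
- by move=> b; rewrite inE => /orP[/eqP->//|/s1].
- move=> v vU; rewrite big_cons.
  have vF : v - '[v, u] *: u \in F.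
    rewrite memF (memvB vU (memvZ _ uU)) dotDr dotNr dotZr uu mulr1.
    by rewrite (dotC v) subrr eqxx.
  rewrite -[LHS](subrK ('[v, u] *: u)) addrC; congr (_ + _).
  rewrite [LHS](sE _ vF); apply: eq_big_seq => b /sF.
  by rewrite memF => /andP[_ /eqP ub]; rewrite dotDl dotNl dotZl ub mulr0 oppr0 addr0.
Qed.

End InnerProduct.

(** * Jordan identities and idempotents *)

Section JordanIdentities.
Context (R : realType) (V : vectType R) (A : euclideanJordanAlgebra V).

Local Notation "x • y" := (jmul A x y) (at level 40, left associativity).
Local Notation "'[ u , v ]" := (jdot A u v) : ring_scope.
Implicit Types (a b c u v w x y z : V) (U : {vspace V}).

Lemma jmulDl x y z : (x + y) • z = x • z + y • z.
Proof. exact: linearDl. Qed.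

Lemma jmulDr x y z : x • (y + z) = x • y + x • z.
Proof. exact: linearDr. Qed.

Lemma jmulNl x y : (- x) • y = - (x • y).
Proof. exact: linearNl. Qed.

Lemma jmulNr x y : x • (- y) = - (x • y).
Proof. exact: linearNr. Qed.

Lemma jmulZl k x y : (k *: x) • y = k *: (x • y).
Proof. exact: linearZl_LR. Qed.

Lemma jmulZr k x y : x • (k *: y) = k *: (x • y).
Proof. exact: linearZr_LR. Qed.

Lemma jmul0l x : 0 • x = 0.
Proof. exact: linear0l. Qed.

Lemma jmul0r x : x • 0 = 0.
Proof. exact: linear0r. Qed.

Definition jmulE := (jmulDl, jmulDr, jmulNl, jmulNr, jmulZl, jmulZr, jmul0l, jmul0r).

Lemma jmul_suml (I : Type) (r : seq I) (P : pred I) (F : I -> V) v :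
  (\sum_(i <- r | P i) F i) • v = \sum_(i <- r | P i) (F i • v).
Proof. exact: linear_sumlz. Qed.

Lemma jmul_sumr (I : Type) (r : seq I) (P : pred I) (F : I -> V) v :
  v • (\sum_(i <- r | P i) F i) = \sum_(i <- r | P i) (v • F i).
Proof. exact: linear_sumr. Qed.

Definition mulop x : 'End(V) := linfun (jmul A x).

Lemma mulopE x y : mulop x y = x • y.
Proof. by rewrite lfunE. Qed.

Lemma mulop_sym x u v : '[mulop x u, v] = '[u, mulop x v].
Proof. by rewrite !mulopE jdot_jmul. Qed.

(** Full polarization of the Jordan identity: it is cubic in [x], and
    this is the associated symmetric trilinear identity. *)
Lemma jordan_linearized x y z w :
  x • ((y • z) • w) + y • ((z • x) • w) + z • ((x • y) • w) =
  (y • z) • (x • w) + (z • x) • (y • w) + (x • y) • (z • w).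
Proof.
apply: (@dot_inj _ _ (jdot A)) => u.
have J t : '[t • ((t • t) • w), u] = '[(t • t) • (t • w), u].
  by rewrite jmul_jordan.
move: (J (x + y + z)) (J (x + y)) (J (y + z)) (J (x + z)) (J x) (J y) (J z).
rewrite !(jmulDl, jmulDr, dotDl) (jmulC A z x) (jmulC A y x) (jmulC A z y).
lra.
Qed.

(** This is [jordan_linearized] at [x, x, w], read as a formula for the
    multiplication by [(x • x) • y] in terms of those by [x • x], [x • y],
    [x] and [y]. *)
Lemma jordan_square x y w :
  ((x • x) • y) • w =
  (x • x) • (y • w) + 2 *: ((x • y) • (x • w)) - 2 *: (x • (y • (x • w))).
Proof.
apply: (@dot_inj _ _ (jdot A)) => u.
have := congr1 (fun v => '[v, u]) (jordan_linearized x x w y).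
rewrite /= (jmulC A w x) (jmulC A ((x • x) • y)) (jmulC A y w).
rewrite (jmulC A y (x • w)) (jmulC A (x • y) (x • w)) !dotE.
lra.
Qed.

Lemma mulop_comm_of_eq0 x y w : x • y = 0 -> x • x = x -> x • (y • w) = y • (x • w).
Proof.
move=> xy xx; have := jordan_linearized x x y w.
rewrite xy (jmulC A y x) xy xx !(jmul0l, jmul0r, addr0, add0r) => ->.
by [].
Qed.

End JordanIdentities.

Section Idempotents.
Context (R : realType) (V : vectType R) (A : euclideanJordanAlgebra V).

Local Notation "x • y" := (jmul A x y) (at level 40, left associativity).
Local Notation "'[ u , v ]" := (jdot A u v) : ring_scope.
Implicit Types (a b u v w x y z : V) (U : {vspace V}).
Context (c : V) (cc : idempotent_elt A c).

(** With [L] the multiplication by [c], the identity [jordan_square] at [c] and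
    [c] reads [2 L^3 - 3 L^2 + L = 0], so the eigenvalues of [L] are among [0],
    [1/2], [1]. *)
Lemma idempotent_cubic v :
  c • (c • (c • v)) = (3 / 2) *: (c • (c • v)) - 2^-1 *: (c • v).
Proof.
apply: (@dot_inj _ _ (jdot A)) => u.
have := congr1 (fun v => '[v, u]) (jordan_square A c c v).
by rewrite !cc !dotE; lra.
Qed.

(** On the eigenvalues [0], [1/2], [1] of [L], the multiplication by [c], the
    polynomials [t] and [t ^+ 2 + 4 * (t - t ^+ 2) ^+ 2] agree. This exhibits
    [L] as a sum of squares of selfadjoint operators. *)
Lemma dot_idempotent v : '[c • v, v] = '[c • v, c • v] +
  4 * '[c • v - c • (c • v), c • v - c • (c • v)].
Proof.
have h2 := congr1 (fun w => '[w, v]) (idempotent_cubic v).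
have h3 := congr1 (fun w => '[c • w, v]) (idempotent_cubic v).
move: h2 h3; rewrite /= !(jmulDr, jmulNr, jmulZr, dotE).
have sw x y : '[c • x, c • y] = '[c • (c • x), y] by rewrite -jdot_jmul.
rewrite !sw.
lra.
Qed.

Lemma dot_idempotent_ge0 v : 0 <= '[c • v, v].
Proof. by rewrite dot_idempotent addr_ge0 ?mulr_ge0 ?dot_ge0. Qed.

Lemma dot_idempotent_eq0 v : '[c • v, v] = 0 -> c • v = 0.
Proof.
rewrite dot_idempotent => h; apply: (@dot_eq0 _ _ (jdot A)).
have := dot_ge0 (jdot A) (c • v).
have := dot_ge0 (jdot A) (c • v - c • (c • v)).
lra.
Qed.

(** The Peirce spaces [V_1(c)] and [V_0(c)] consist of elements whose
    multiplication commutes with that of [c]; the Jordan identity polarized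
    at [c, c, a] says so. *)
Lemma peirce0_comm a b : c • a = 0 -> c • (a • b) = a • (c • b).
Proof. by move=> ca; apply: mulop_comm_of_eq0. Qed.

Lemma peirce1_comm a b : c • a = a -> c • (a • b) = a • (c • b).
Proof.
move=> ca; have := jordan_linearized A c c a b.
rewrite (jmulC A a c) ca cc => h; apply: (@dot_inj _ _ (jdot A)) => u.
have := congr1 (fun w => '[w, u]) h.
rewrite /= !dotE; lra.
Qed.

Lemma peirce1_mul a b : c • a = a -> c • b = b -> c • (a • b) = a • b.
Proof. by move=> ca cb; rewrite peirce1_comm ?cb. Qed.

Lemma peirce0_mul a b : c • a = 0 -> c • b = 0 -> c • (a • b) = 0.
Proof. by move=> ca cb; rewrite peirce0_comm // cb jmul0r. Qed.

Lemma peirce10_mul a b : c • a = a -> c • b = 0 -> a • b = 0.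
Proof.
move=> ca cb; have := peirce0_comm a cb.
by rewrite ca jmulC (jmulC A b) -jmulC peirce1_comm // cb jmul0r.
Qed.

End Idempotents.

(** * Spectral decomposition *)

(** A subspace of maximal dimension among those on which [P] holds contains
    every [v] with [P v], since it could be enlarged by [v] otherwise. *)
Lemma vspace_of_predicate (K : fieldType) (V : vectType K) (P : V -> Prop) :
  P 0 -> (forall a u v, P u -> P v -> P (a *: u + v)) ->
  exists U : {vspace V}, forall v, v \in U <-> P v.
Proof.
move=> P0 PD.
pose below (U : {vspace V}) := forall v, v \in U -> P v.
pose Q n := `[< exists2 U, below U & \dim U = n >].
have Q0 : exists n, Q n.
  exists 0%N; apply/asboolP; exists 0%VS; last by rewrite dimv0.
  by move=> v; rewrite memv0 => /eqP->.
have Qle n : Q n -> (n <= \dim {:V})%N.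
  by move=> /asboolP[U _ <-]; apply/dimvS/subvf.
have [n /asboolP[U UP dU] dmax] := ex_maxnP Q0 Qle.
exists U => v; split => [/UP//|Pv].
have Q' : Q (\dim (U + <[v]>)).
  apply/asboolP; exists (U + <[v]>)%VS => // w /memv_addP[u /UP Pu [t]].
  case/vlineP => k -> ->; rewrite addrC; exact: PD.
have := dmax _ Q'; rewrite -dU.
rewrite leqNgt (ltn_leqif (dimv_leqif_sup (addvSl _ _))) negbK subv_add.
by case/andP => _; rewrite -memvE.
Qed.

Section Spectral.
Context (R : realType) (V : vectType R) (A : euclideanJordanAlgebra V).
Context (e : V) (he : is_unit A e).

Local Notation "x • y" := (jmul A x y) (at level 40, left associativity).
Local Notation "'[ u , v ]" := (jdot A u v) : ring_scope.
Implicit Types (a b u v w x y z : V) (U : {vspace V}).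

Definition subalgebra U := forall a b, a \in U -> b \in U -> a • b \in U.

Lemma jmul1l x : e • x = x. Proof. by have [] := he x. Qed.

Lemma jmul1r x : x • e = x. Proof. by have [] := he x. Qed.

(** The algebra is formally real because [<x, x> = <e, x • x>]. *)
Lemma square_eq0 x : x • x = 0 -> x = 0.
Proof.
move=> xx; apply: (@dot_eq0 _ _ (jdot A)).
by rewrite -{1}(jmul1r x) jdot_jmul xx dot0r.
Qed.

(** Write [L u] for the multiplication by [u]. The operator [L x] preserves
    this set of elements of [U], by the identity [jordan_square]: it expresses [L (x • (x • u))] through [L u],
    [L (x • u)], [L x], [L (x • x)], which all commute with [L x]. So the set
    contains the powers of [x]. Keeping both [u] and [x • u] in the condition
    is what makes the set stable. *)
Definition powerlike U x u :=
  [/\ u \in U, (x • x) • u = x • (x • u),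
      forall w, x • (u • w) = u • (x • w) &
      forall w, x • ((x • u) • w) = (x • u) • (x • w)].

Lemma powerlike_self U x : subalgebra U -> x \in U -> powerlike U x x.
Proof.
move=> Ualg xU; split=> // [|w]; first by rewrite jmulC.
by rewrite jmul_jordan.
Qed.

Lemma powerlike_mul U x u :
  subalgebra U -> x \in U -> powerlike U x u -> powerlike U x (x • u).
Proof.
move=> Ualg xU [uU x2u ux xux]; split.
- exact: Ualg.
- by rewrite -jmul_jordan x2u.
- exact: xux.
- move=> w; rewrite -x2u !(jordan_square A x u) !jmulDr jmulNr !jmulZr.
  by rewrite jmul_jordan xux !ux.
Qed.

Lemma powerlike_vspace U x :
  exists W : {vspace V}, forall u, u \in W <-> powerlike U x u.
Proof.
apply: vspace_of_predicate => [|k u v [uU u1 u2 u3] [vU v1 v2 v3]].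
  by split; rewrite ?mem0v ?jmulE // => w; rewrite !jmulE.
split; first by rewrite memvD ?memvZ.
- by rewrite !jmulE u1 v1.
- by move=> w; rewrite !jmulE u2 v2.
- by move=> w; rewrite !jmulE u3 v3.
Qed.

(** The multiplication by [x] is diagonalizable on the space of powerlike
    elements; write [x] as a sum of eigenvectors [u] with distinct
    eigenvalues [k]. Since [L u] commutes with [L x], the product of two of
    them is an eigenvector for both eigenvalues, hence [0]. It follows that
    [k *: u = x • u = u • u], and [k^-1 *: u] is an idempotent. *)
Lemma spectral_decomposition U x :
  subalgebra U -> x \in U ->
  exists m (mu : 'I_m -> R) (d : 'I_m -> V),
    [/\ x = \sum_i mu i *: d i, forall i, d i \in U,
        forall i, idempotent_elt A (d i), forall i, d i != 0 &
        forall i j, i != j -> d i • d j = 0].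
Proof.
move=> Ualg xU; have [W WP] := powerlike_vspace U x.
have xW : x \in W by apply/WP/powerlike_self.
have WT u : u \in W -> mulop A x u \in W.
  by rewrite mulopE => /WP ?; apply/WP/powerlike_mul.
have [s [us xE sP]] := selfadjoint_decomposition (mulop_sym A x) WT xW.
pose p (i : 'I_(size s)) := tnth (in_tuple s) i.
have pP i : [/\ (p i).2 \in W, (p i).2 != 0 & x • (p i).2 = (p i).1 *: (p i).2].
  by have := sP _ (mem_tnth i (in_tuple s)); rewrite mulopE.
have xE' : x = \sum_i (p i).2 by rewrite xE big_tnth.
have neq i j : i != j -> (p i).1 != (p j).1.
  apply: contraNneq => pij; apply/eqP/val_inj.
  have sz (k : 'I_(size s)) : (val k < size (map fst s))%N by rewrite size_map ltn_ord.
  apply/eqP; rewrite -(nth_uniq 0 (sz i) (sz j) us).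
  rewrite !(nth_map (0, 0)) ?ltn_ord //.
  by rewrite -!(tnth_nth _ (in_tuple s)) pij.
have commp i w : x • ((p i).2 • w) = (p i).2 • (x • w).
  by have [/WP[]] := pP i.
have orth i j : i != j -> (p i).2 • (p j).2 = 0.
  move=> ij; have [_ _ hi] := pP i; have [_ _ hj] := pP j.
  have h1 := commp i (p j).2; have h2 := commp j (p i).2.
  rewrite hj jmulZr in h1; rewrite hi jmulZr (jmulC A (p j).2) in h2.
  apply/eqP; move: h1; rewrite h2 => /eqP.
  by rewrite -subr_eq0 -scalerBl scaler_eq0 subr_eq0 (negPf (neq _ _ ij)).
have sq i : (p i).2 • (p i).2 = (p i).1 *: (p i).2.
  have [_ _ <-] := pP i; rewrite xE' jmul_suml (bigD1 i) //= big1 ?addr0 //.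
  by move=> j /orth.
have p0 i : (p i).1 != 0.
  have [_ + _] := pP i; apply: contraNneq => h.
  by apply/eqP/square_eq0; rewrite sq h scale0r.
exists (size s), (fun i => (p i).1), (fun i => (p i).1^-1 *: (p i).2); split.
- by rewrite {1}xE'; apply: eq_bigr => i _; rewrite scalerA divff // scale1r.
- by move=> i; apply: memvZ; have [/WP[]] := pP i.
- by move=> i; rewrite /idempotent_elt !jmulE sq (scalerA _ (p i).1) mulVf // scale1r.
- by move=> i; have [_ h _] := pP i; rewrite scaler_eq0 invr_eq0 (negPf (p0 i)).
- by move=> i j ij; rewrite !jmulE orth // !scaler0.
Qed.

End Spectral.

(** * The cone of squares *)

Section Cone.
Context (R : realType) (V : vectType R) (A : euclideanJordanAlgebra V).
Context (e : V) (he : is_unit A e).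

Local Notation "x • y" := (jmul A x y) (at level 40, left associativity).
Local Notation "'[ u , v ]" := (jdot A u v) : ring_scope.
Local Notation cone := (cone_of_squares A).
Implicit Types (a b c d q u v w x y z : V) (U : {vspace V}).

Definition peirce1 c : {vspace V} := lker (mulop A c - \1%VF).

Lemma mem_peirce1 c v : (v \in peirce1 c) = (c • v == v).
Proof.
by rewrite memv_ker add_lfunE opp_lfunE id_lfunE mulopE subr_eq0.
Qed.

Lemma peirce1_subalgebra c : idempotent_elt A c -> subalgebra A (peirce1 c).
Proof.
move=> cc a b; rewrite !mem_peirce1 => /eqP ca /eqP cb.
by rewrite (peirce1_mul cc).
Qed.

Lemma dot_square_idempotent c q : '[c, q • q] = '[c • q, q].
Proof. by rewrite dotC jdot_jmul dotC (jmulC A q c). Qed.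

Lemma dot_idempotent_square_ge0 c q : idempotent_elt A c -> 0 <= '[c, q • q].
Proof. by move=> cc; rewrite dot_square_idempotent dot_idempotent_ge0. Qed.

Lemma dot_orthogonal c d : idempotent_elt A c -> c • d = 0 -> '[c, d] = 0.
Proof. by move=> cc cd; rewrite -cc jdot_jmul cd dot0r. Qed.

Lemma dot_sum_orthogonal m (mu : 'I_m -> R) (d : 'I_m -> V) i :
  (forall i, idempotent_elt A (d i)) -> (forall i j, i != j -> d i • d j = 0) ->
  '[\sum_j mu j *: d j, d i] = mu i * '[d i, d i].
Proof.
move=> dd orth; rewrite dot_suml (bigD1 i) //= big1 ?addr0 ?dotZl // => j ji.
by rewrite dotZl (dot_orthogonal (dd j)) ?mulr0 ?orth.
Qed.

(** The cone of squares is selfdual. A square is a nonnegative combination of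
    idempotents, and [<c, q • q>] equals [<c • q, q>], which is nonnegative
    for an idempotent [c]; conversely the coefficients of the spectral
    decomposition of [y] are the numbers [<y, d> / <d, d>] with [d = d • d]. *)
Lemma coneP y : cone y <-> forall q, 0 <= '[y, q • q].
Proof.
have sub z : z \in fullv by exact: memvf.
split=> [[x ->{y}] q|ypos].
  have [//|m [mu [d [-> _ dd _ orth]]]] :=
    @spectral_decomposition _ _ A e he fullv x _ (sub x).
  rewrite jmul_suml dot_suml sumr_ge0 // => i _.
  rewrite jmulZl jmul_sumr (bigD1 i) //= big1 => [|j ji]; last first.
    by rewrite jmulZr orth ?scaler0 // eq_sym.
  rewrite addr0 jmulZr dd !dotZl mulrA.
  by rewrite mulr_ge0 ?dot_idempotent_square_ge0 // -expr2 sqr_ge0.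
have [//|m [mu [d [yE _ dd d0 orth]]]] :=
    @spectral_decomposition _ _ A e he fullv y _ (sub y).
have mu0 i : 0 <= mu i.
  have := ypos (d i); rewrite dd yE dot_sum_orthogonal // pmulr_lge0 //.
  exact: dot_gt0.
exists (\sum_i Num.sqrt (mu i) *: d i).
rewrite yE jmul_suml; apply: eq_bigr => i _.
rewrite jmulZl jmul_sumr (bigD1 i) //= big1 => [|j ji]; last first.
  by rewrite jmulZr orth ?scaler0 // eq_sym.
by rewrite addr0 jmulZr dd scalerA -expr2 sqr_sqrtr.
Qed.

Lemma coneD x y : cone x -> cone y -> cone (x + y).
Proof.
by move=> /coneP xP /coneP yP; apply/coneP => q; rewrite dotDl addr_ge0.
Qed.

Lemma coneZ k x : 0 <= k -> cone x -> cone (k *: x).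
Proof. by move=> k0 /coneP xP; apply/coneP => q; rewrite dotZl mulr_ge0. Qed.

Lemma cone_idempotent c : idempotent_elt A c -> cone c.
Proof. by move=> cc; exists c. Qed.

Lemma unit_idempotent : idempotent_elt A e.
Proof. exact: jmul1l. Qed.

Lemma cone0 : cone 0.
Proof. by exists 0; rewrite jmul0l. Qed.

Lemma cone_sum m (mu : 'I_m -> R) (d : 'I_m -> V) :
  (forall i, idempotent_elt A (d i)) -> (forall i, 0 <= mu i) ->
  cone (\sum_i mu i *: d i).
Proof.
move=> dd mu0; elim/big_rec: _ => [|i x _ xK]; first exact: cone0.
by apply: coneD => //; apply: coneZ => //; apply: cone_idempotent.
Qed.

Lemma cone_dot_ge0 c y : idempotent_elt A c -> cone y -> 0 <= '[y, c].
Proof. by move=> cc /coneP /(_ c); rewrite cc. Qed.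

(** If [y = q • q] then [<y, c> = <c • q, q>], so [c • q = 0] and [q] lies in
    the subalgebra [V_0(c)]. *)
Lemma cone_dot_le0 c y : idempotent_elt A c -> cone y -> '[y, c] <= 0 -> c • y = 0.
Proof.
move=> cc yK y0; have /eqP : '[y, c] == 0 by rewrite eq_le y0 cone_dot_ge0.
case: yK => q ->; rewrite dotC dot_square_idempotent => /(dot_idempotent_eq0 cc) cq.
exact: peirce0_mul.
Qed.

(** The idempotent [c] is an order unit of [V_1(c)]: the idempotents [d] of the
    spectral decomposition of [w] in [V_1(c)] are below [c], as [c - d] is
    an idempotent. *)
Lemma peirce1_order_unit c w : idempotent_elt A c -> c • w = w ->
  exists2 B : R, 0 <= B & forall q, `|'[w, q • q]| <= B * '[c, q • q].
Proof.
move=> cc cw; have wU : w \in peirce1 c by rewrite mem_peirce1 cw.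
have [m [mu [d [wE dU dd _ _]]]] :=
  spectral_decomposition he (peirce1_subalgebra cc) wU.
exists (\sum_i `|mu i|) => [|q]; first exact: sumr_ge0.
rewrite wE dot_suml mulr_suml; apply: le_trans (ler_norm_sum _ _ _) _.
apply: ler_sum => i _; rewrite dotZl normrM ler_wpM2l //.
rewrite ger0_norm ?dot_idempotent_square_ge0 //.
have : idempotent_elt A (c - d i).
  move: (dU i); rewrite mem_peirce1 => /eqP cd; rewrite /idempotent_elt.
  rewrite jmulDl jmulNl !jmulDr !jmulNr cc (jmulC A (d i) c) cd dd.
  by rewrite subrr subr0.
by move/(dot_idempotent_square_ge0 q); rewrite dotDl dotNl subr_ge0.
Qed.

(** Uniformity in [v] comes from expanding [v] in an orthonormal family. *)
Lemma unit_order_bound : exists2 B : R, 0 <= B &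
  forall v q, `|'[v, q • q]| <= jnorm A v * B * '[e, q • q].
Proof.
have [s [_ s1 sE]] := orthonormal_expansion (jdot A) fullv.
have [B B0 BP] : exists2 B : V -> R, forall b, 0 <= B b &
    forall b q, `|'[b, q • q]| <= B b * '[e, q • q].
  have h b := peirce1_order_unit unit_idempotent (jmul1l he b).
  exists (fun b => s2val (cid2 (h b))) => b; first exact: (s2valP (cid2 (h b))).
  exact: (s2valP' (cid2 (h b))).
exists (\sum_(b <- s) B b) => [|v q]; first exact: sumr_ge0.
have eq0 := dot_idempotent_square_ge0 q unit_idempotent.
rewrite {1}(sE v (memvf v)) dot_suml mulr_sumr mulr_suml.
apply: le_trans (ler_norm_sum _ _ _) _.
rewrite big_seq [leRHS]big_seq; apply: ler_sum => b /s1 b1.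
rewrite dotZl normrM -mulrA; apply: ler_pM => //.
rewrite -sqrtr_sqr ler_wsqrtr //.
by have := cauchy_schwarz (jdot A) v b; rewrite b1 mulr1.
Qed.

Lemma open_cone_of_unit_le z (s : R) : 0 < s -> cone (s *: z - e) -> open_cone A z.
Proof.
move=> s0 /coneP zP; have [B B0 BP] := unit_order_bound.
exists (s * (B + 1))^-1 => [|y hy]; first by rewrite invr_gt0 mulr_gt0 // ltr_wpDl.
apply/coneP => q; have := BP (y - z) q; have := zP q.
have := dot_idempotent_square_ge0 q unit_idempotent.
have : 0 <= jnorm A (y - z) by exact: sqrtr_ge0.
move: hy; rewrite !dotE; move: (jnorm _ _) => r hr r0 e0 z0 yz.
have sr : s * (r * B) <= 1.
  have B1 : 0 < B + 1 by rewrite ltr_wpDl.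
  move: hr; rewrite -[_^-1]mul1r ltr_pdivlMr ?mulr_gt0 // => hr.
  have : 0 <= s * r by rewrite mulr_ge0 // ltW.
  nra.
have : - (r * B * '[e, q • q]) <= '[y, q • q] - '[z, q • q].
  by move: yz; rewrite ler_norml => /andP[].
move: ('[y, q • q]) ('[z, q • q]) e0 z0 {yz}; move: ('[e, q • q]) => E Y Z E0 ZE YZ.
have h : s * (r * B) * E <= E by rewrite ler_piMl.
have : 0 <= s * Y by nra.
by rewrite pmulr_rge0.
Qed.

Lemma open_cone_absorbing y v : open_cone A y ->
  exists2 t : R, 0 < t & cone (y - t *: v).
Proof.
move=> [eps eps0 yP]; have n0 : 0 <= jnorm A v by exact: sqrtr_ge0.
have n1 : 0 < jnorm A v + 1 by rewrite ltr_wpDl.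
exists (eps / (jnorm A v + 1)); first by rewrite divr_gt0.
apply: yP; rewrite addrC addrA addNr add0r -scaleNr /jnorm !dotE -/(jnorm A v).
rewrite mulrA -expr2 sqrrN sqrtrM ?sqr_ge0 // sqrtr_sqr -/(jnorm A v).
by rewrite ger0_norm ?divr_ge0 ?ltW // mulrAC ltr_pdivrMr // ltr_pM2l // ltrDl.
Qed.

Lemma open_cone_cone y : open_cone A y -> cone y.
Proof.
by move=> [eps eps0 yP]; apply: yP; rewrite subrr /jnorm dot0l sqrtr0.
Qed.

End Cone.

(** * Peirce decomposition along a Jordan frame *)

Lemma half_add (R : realFieldType) (V : lmodType R) (v : V) :
  2^-1 *: v + 2^-1 *: v = v.
Proof. by rewrite -scalerDl -[2^-1]mul1r -splitr scale1r. Qed.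

Lemma half_two (R : realFieldType) (V : lmodType R) (v : V) :
  ((1 + 1) / 2) *: v = v.
Proof. by rewrite mulrDl scalerDl !mul1r half_add. Qed.

Section Peirce.
Context (R : realType) (V : vectType R) (A : euclideanJordanAlgebra V).
Context (e : V) (he : is_unit A e).
Context (r : nat) (c : 'I_r -> V) (cframe : jordan_frame A e c).

Local Notation "x • y" := (jmul A x y) (at level 40, left associativity).
Local Notation "'[ u , v ]" := (jdot A u v) : ring_scope.
Local Notation cone := (cone_of_squares A).
Implicit Types (a b u v w x y z : V) (U : {vspace V}) (i j k l m : 'I_r).
Implicit Types (J : {set 'I_r}).

Lemma frame_idempotent i : idempotent_elt A (c i).
Proof. by case: cframe => /(_ i)[]. Qed.

Lemma frame_neq0 i : c i != 0.
Proof. by case: cframe => /(_ i)[]. Qed.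

Lemma frame_orthogonal i j : i != j -> c i • c j = 0.
Proof. by case: cframe => _ /(_ i j). Qed.

Lemma frame_sum : \sum_i c i = e.
Proof. by case: cframe. Qed.

Local Notation cc := frame_idempotent.
Local Notation orth := frame_orthogonal.

Lemma frame_dot_gt0 i : 0 < '[c i, c i].
Proof. exact/dot_gt0/frame_neq0. Qed.

Lemma frame_mul_sum (P : pred 'I_r) (f : 'I_r -> R) i :
  c i • (\sum_(j | P j) f j *: c j) = (if P i then f i else 0) *: c i.
Proof.
rewrite jmul_sumr; case: ifP => Pi.
  rewrite (bigD1 i) //= jmulZr cc big1 ?addr0 // => j /andP[_ ji].
  by rewrite jmulZr orth ?scaler0 // eq_sym.
rewrite scale0r big1 // => j Pj; rewrite jmulZr orth ?scaler0 //.
by apply: contraFneq Pi => ->.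
Qed.

Definition frame_part J := \sum_(j in J) c j.

Lemma frame_mul_part J i : c i • frame_part J = (i \in J)%:R *: c i.
Proof.
have -> : frame_part J = \sum_(j in J) 1 *: c j.
  by apply: eq_bigr => j _; rewrite scale1r.
by rewrite frame_mul_sum; case: ifP.
Qed.

Lemma frame_part_idempotent J : idempotent_elt A (frame_part J).
Proof.
rewrite /idempotent_elt {1}/frame_part jmul_suml; apply: eq_bigr => i iJ.
by rewrite frame_mul_part iJ scale1r.
Qed.

Lemma frame_partT : frame_part [set: 'I_r] = e.
Proof. by rewrite -frame_sum; apply: eq_bigl => i; rewrite inE. Qed.

(** For [i != j] this is the Peirce space [V_ij], and [V_ii = V_1(c i)] for
    [i = j]: the eigenvalue of [c m] on [V_ij] is half the number of times
    that [m] occurs in the pair. *)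
Definition peirce i j : {vspace V} :=
  (\bigcap_(m < r)
     lker (mulop A (c m) - (((m == i)%:R + (m == j)%:R) / 2) *: \1%VF))%VS.

Lemma peirceP i j v : reflect
  (forall m, c m • v = (((m == i)%:R + (m == j)%:R) / 2) *: v)
  (v \in peirce i j).
Proof.
rewrite memvE; apply: (iffP subv_bigcapP) => [h m|h m _].
  have := h m isT; rewrite -memvE memv_ker add_lfunE opp_lfunE scale_lfunE.
  by rewrite id_lfunE mulopE subr_eq0 => /eqP.
rewrite -memvE memv_ker add_lfunE opp_lfunE scale_lfunE id_lfunE mulopE.
by rewrite h subrr.
Qed.

Lemma peirceC i j : peirce i j = peirce j i.
Proof. by apply: eq_bigr => m _; rewrite [(m == i)%:R + _]addrC. Qed.

Lemma peirce_l i j v : i != j -> v \in peirce i j -> c i • v = 2^-1 *: v.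
Proof.
by move=> ij /peirceP ->; rewrite eqxx (negPf ij) addr0 mul1r.
Qed.

Lemma peirce_r i j v : i != j -> v \in peirce i j -> c j • v = 2^-1 *: v.
Proof. by rewrite peirceC eq_sym; exact: peirce_l. Qed.

Lemma peirce_other i j m v : m != i -> m != j -> v \in peirce i j -> c m • v = 0.
Proof.
by move=> /negPf mi /negPf mj /peirceP ->; rewrite mi mj addr0 mul0r scale0r.
Qed.

Lemma frame_pair_idempotent i j : i != j -> idempotent_elt A (c i + c j).
Proof.
move=> ij; rewrite /idempotent_elt !(jmulDl, jmulDr) !cc (jmulC A (c j)).
by rewrite orth // addr0 add0r.
Qed.

(** For [m] other than [i] and [j], the vector [v] lies in [V_1(c i + c j)] and
    [c m] in [V_0(c i + c j)], so their product vanishes. *)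
Lemma peirce_intro i j v : i != j ->
  c i • v = 2^-1 *: v -> c j • v = 2^-1 *: v -> v \in peirce i j.
Proof.
move=> ij civ cjv; apply/peirceP => m.
have [->|mi] := eqVneq m i; first by rewrite (negPf ij) addr0 mul1r.
have [->|mj] := eqVneq m j; first by rewrite add0r mul1r.
rewrite addr0 mul0r scale0r jmulC.
apply: (peirce10_mul (frame_pair_idempotent ij)).
  by rewrite jmulDl civ cjv half_add.
by rewrite jmulDl !orth ?addr0 // eq_sym.
Qed.

Lemma peirce_diagE i v : (v \in peirce i i) = (c i • v == v).
Proof.
apply/peirceP/eqP => [->|cv m]; first by rewrite eqxx half_two.
have [->|mi] := eqVneq m i; first by rewrite half_two.
rewrite addr0 mul0r scale0r jmulC.
by apply: (peirce10_mul (cc i)) => //; rewrite orth // eq_sym.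
Qed.

Lemma frame_comm i j v : i != j -> c i • (c j • v) = c j • (c i • v).
Proof. by move=> ij; rewrite (peirce0_comm (cc i)) ?orth. Qed.

(** Up to a factor [4], the composite of the multiplications by [c i] and [c j]
    is the projection on [V_ij]. *)
Lemma frame_peirce_offdiag i j v : i != j -> c i • (c j • v) \in peirce i j.
Proof.
have half k l w : k != l -> c k • (c k • (c l • w)) = 2^-1 *: (c k • (c l • w)).
  move=> kl; have := jordan_square A (c k) (c l) w.
  rewrite cc orth // !jmul0l scaler0 addr0 (frame_comm w (_ : l != k)) 1?eq_sym //.
  move=> /eqP; rewrite eq_sym subr_eq0 => /eqP h.
  by rewrite [in RHS]h scalerA mulVf ?pnatr_eq0 // scale1r.
move=> ij; apply: peirce_intro => //; first exact: half.
by rewrite (frame_comm v ij) half // eq_sym.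
Qed.

(** The polynomial [2 t^2 - t] takes the values [0], [0], [1] at the eigenvalues
    [0], [1/2], [1] of the multiplication by [c i]. *)
Lemma frame_peirce_diag i v : 2 *: (c i • (c i • v)) - c i • v \in peirce i i.
Proof.
rewrite peirce_diagE; apply/eqP; rewrite jmulDr jmulNr jmulZr (idempotent_cubic (cc i)).
apply: (@dot_inj _ _ (jdot A)) => u; rewrite !dotE; lra.
Qed.

Lemma sub_peirce_part i j J : i \in J -> j \in J ->
  (peirce i j <= peirce1 A (frame_part J))%VS.
Proof.
move=> iJ jJ; apply/subvP => v vP; rewrite mem_peirce1 jmul_suml.
have [ij|ij] := eqVneq i j.
  move: vP; rewrite -ij => /peirceP cv; rewrite (bigD1 i) //= big1 => [|m /andP[_ mi]].
    by rewrite cv eqxx half_two addr0.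
  by rewrite cv (negPf mi) addr0 mul0r scale0r.
rewrite (bigD1 i) //= (bigD1 j) /=; last by rewrite jJ eq_sym.
rewrite big1 => [|m /andP[/andP[_ mi] mj]]; last by rewrite (peirce_other mi mj).
by rewrite (peirce_l ij) // (peirce_r ij) // addr0 half_add.
Qed.

(** With [L] the sum of the multiplications [L_i] by the [c i], [i] in [J], a
    vector fixed by [L] equals [(2 L^2 - L) v], and this operator is the sum of
    the [2 L_i^2 - L_i] and of the [2 L_i L_j] with [i != j]. *)
Lemma peirce_part_sum J :
  peirce1 A (frame_part J) =
  (\sum_(p : 'I_r * 'I_r | [&& p.1 \in J, p.2 \in J & p.1 <= p.2]%N)
     peirce p.1 p.2)%VS.
Proof.
apply/eqP; rewrite eqEsubv; apply/andP; split; last first.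
  by apply/subv_sumP => p /and3P[p1 p2 _]; exact: sub_peirce_part.
set W := (\sum_(p | _) _)%VS.
have sub i j : i \in J -> j \in J -> (peirce i j <= W)%VS.
  move=> iJ jJ; case: (leqP i j) => [ij|/ltnW ij].
    by apply: (sumv_sup (i, j)); rewrite //= iJ jJ.
  by rewrite peirceC; apply: (sumv_sup (j, i)); rewrite //= iJ jJ.
apply/subvP => v; rewrite mem_peirce1 => /eqP Lv.
have -> : v = \sum_(i in J) ((2 *: (c i • (c i • v)) - c i • v) +
                 \sum_(j in J | j != i) 2 *: (c i • (c j • v))).
  transitivity (2 *: (frame_part J • (frame_part J • v)) - frame_part J • v).
    by rewrite !Lv scaler_nat mulr2n addrK.
  rewrite /frame_part !jmul_suml scaler_sumr -sumrB; apply: eq_bigr => i iJ.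
  rewrite jmul_sumr (bigD1 i) //= scalerDr scaler_sumr -!addrA.
  by congr (_ + _); rewrite addrC.
apply: memv_suml => i iJ; apply: memvD.
  exact: (subvP (sub i i iJ iJ)) (frame_peirce_diag i v).
apply: memv_suml => j /andP[jJ ji]; apply: memvZ.
by apply: (subvP (sub i j iJ jJ)); apply: frame_peirce_offdiag; rewrite eq_sym.
Qed.

(** Eigenvectors of the selfadjoint multiplications by the [c m] are orthogonal
    unless all the eigenvalues agree, and these determine the unordered pair
    of indices. *)
Lemma peirce_orthogonal i j k l u v : (i <= j)%N -> (k <= l)%N ->
  (i, j) != (k, l) -> u \in peirce i j -> v \in peirce k l -> '[u, v] = 0.
Proof.
move=> ij kl neq /peirceP uP /peirceP vP; apply/eqP; apply: contraNT neq => uv.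
have E m : ((m == i) + (m == j))%N = ((m == k) + (m == l))%N.
  apply/eqP; rewrite -(eqr_nat R) !natrD.
  have /eqP := jdot_jmul A (c m) u v; rewrite uP vP dotZl dotZr.
  by rewrite (inj_eq (mulIf uv)) (inj_eq (mulIf _)) ?invr_eq0 ?pnatr_eq0.
have [ik il] : (i == k) || (i == l) /\ (j == k) || (j == l).
  have := E i; have := E j; rewrite !eqxx.
  by case: (j == k); case: (j == l); case: (i == k); case: (i == l) => //=;
    case: (_ == _).
have [ki li] : (k == i) || (k == j) /\ (l == i) || (l == j).
  have := E k; have := E l; rewrite !eqxx.
  by case: (k == i); case: (k == j); case: (l == i); case: (l == j) => //=;
    case: (_ == _).
rewrite xpair_eqE -!val_eqE /=.
move: ik il ki li; rewrite -!val_eqE /=; lia.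
Qed.

Lemma dim_peirce_part J :
  \dim (peirce1 A (frame_part J)) =
  (\sum_(p : 'I_r * 'I_r | [&& p.1 \in J, p.2 \in J & p.1 <= p.2])
     \dim (peirce p.1 p.2))%N.
Proof.
rewrite peirce_part_sum; apply/eqP; rewrite -directvE /=.
apply/directv_sum_independent => us usP us0 p pP.
apply: (@dot_eq0 _ _ (jdot A)).
have := congr1 (fun v => '[v, us p]) us0; rewrite dot0l dot_suml (bigD1 p) //=.
rewrite big1 ?addr0 // => q /andP[qP qp].
have /and3P[_ _ p12] := pP; have /and3P[_ _ q12] := qP.
by apply: (peirce_orthogonal q12 p12); rewrite ?usP // -!surjective_pairing.
Qed.

(** An idempotent [d] of [V_1(c i)] splits [c i] as [d + (c i - d)], so [d] is
    [0] or [c i] as [c i] is primitive. *)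
Lemma peirce_diag_line i : peirce i i = <[c i]>%VS.
Proof.
apply/eqP; rewrite eqEsubv -memvE peirce_diagE cc eqxx andbT.
apply/subvP => v; rewrite peirce_diagE -mem_peirce1 => vU.
have [m [mu [d [vE dU dd d0 _]]]] :=
  spectral_decomposition he (peirce1_subalgebra (cc i)) vU.
rewrite vE; apply: memv_suml => l _; apply: memvZ.
have := dU l; rewrite mem_peirce1 => /eqP cd.
have [<-|dc] := eqVneq (d l) (c i); first exact: memv_line.
case: cframe => /(_ i)[_ _ []]; exists (d l), (c i - d l).
split; [split=> //|split|..].
- rewrite /idempotent_elt jmulDl jmulNl !jmulDr !jmulNr cc cd dd.
  by rewrite (jmulC A (d l)) cd subrr subr0.
- by rewrite subr_eq0 eq_sym.
- by rewrite jmulDr jmulNr jmulC cd dd subrr.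
- by rewrite addrC subrK.
Qed.

Lemma dim_peirce_diag i : \dim (peirce i i) = 1%N.
Proof. by rewrite peirce_diag_line dim_vline frame_neq0. Qed.

(** Since [a • a] lies in [V_1(c i + c j)] and has no component in [V_ij], it is
    a combination of [c i] and [c j]; pairing with [c i] gives
    [al * <c i, c i> = <a, a> / 2]. *)
Lemma peirce_square i j a : i != j -> a \in peirce i j -> a != 0 ->
  exists al be : R, a • a = al *: c i + be *: c j /\ 0 < al.
Proof.
move=> ij aP a0; have ci := peirce_l ij aP; have cj := peirce_r ij aP.
have cji : c j • c i = 0 by rewrite orth // eq_sym.
(* up to a factor 4, this is the component of [a • a] in [V_ij] *)
have off : c i • (c j • (a • a)) = 0.
  have := jordan_linearized A (c i) a a (c j).
  rewrite (jmulC A a (c i)) ci orth // jmul0r add0r !jmulZl (jmulC A a (c j)) cj.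
  rewrite (jmulC A (a • a) (c j)) !jmulZr.
  move=> h; apply: (@dot_inj _ _ (jdot A)) => u.
  have := congr1 (fun v => '[v, u]) h; rewrite /= !dotE; lra.
have Lv : (c i + c j) • (a • a) = a • a.
  apply: (peirce1_mul (frame_pair_idempotent ij));
  by rewrite jmulDl ci cj half_add.
have sumE : a • a = (2 *: (c i • (c i • (a • a))) - c i • (a • a)) +
                    (2 *: (c j • (c j • (a • a))) - c j • (a • a)).
  have := congr1 (fun v => (c i + c j) • v) Lv; rewrite Lv.
  have off' : c j • (c i • (a • a)) = 0 by rewrite -frame_comm.
  rewrite jmulDl -{1}Lv -{2}Lv !(jmulDl, jmulDr) off off' addr0 add0r.
  move=> h; apply: (@dot_inj _ _ (jdot A)) => u.
  have := congr1 (fun v => '[v, u]) h; have := congr1 (fun v => '[v, u]) Lv.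
  rewrite /= jmulDl !dotE; lra.
have /vlineP[al alE] : 2 *: (c i • (c i • (a • a))) - c i • (a • a) \in <[c i]>%VS.
  by rewrite -peirce_diag_line frame_peirce_diag.
have /vlineP[be beE] : 2 *: (c j • (c j • (a • a))) - c j • (a • a) \in <[c j]>%VS.
  by rewrite -peirce_diag_line frame_peirce_diag.
rewrite alE beE in sumE; exists al, be; split=> //.
have := congr1 (fun v => '[v, c i]) sumE.
rewrite /= dotC dot_square_idempotent ci !dotE (dot_orthogonal (cc j) cji) mulr0 addr0.
move=> h; have : 0 < al * '[c i, c i] by rewrite -h mulr_gt0 ?dot_gt0 ?invr_gt0.
by rewrite pmulr_lgt0 // frame_dot_gt0.
Qed.

(** The multiplication by [c j] commutes with that by [b], and the one by [c k]
    with that by [a], as [b] lies in [V_0(c j)] and [a] in [V_0(c k)]. *)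
Lemma peirce_mul i j k a b : i != j -> i != k -> j != k ->
  a \in peirce i j -> b \in peirce i k -> a • b \in peirce j k.
Proof.
move=> ij ik jk aP bP; apply: peirce_intro => //.
  rewrite jmulC (jmulC A a) jmulC (peirce0_comm (cc j)).
    by rewrite (peirce_r ij) // jmulZr.
  by apply: (peirce_other _ _ bP); rewrite 1?eq_sym // eq_sym.
rewrite (peirce0_comm (cc k)); first by rewrite (peirce_r ik) // jmulZr.
by apply: (peirce_other _ _ aP); rewrite eq_sym.
Qed.

(** As [a • c k = 0], the identity [jordan_square] at [a] and [c k] reduces to
    [a • (a • b) = 1/2 (a • a) • b]. *)
Lemma peirce_mulK i j k a b al be : i != j -> i != k -> j != k ->
  a \in peirce i j -> b \in peirce i k -> a • a = al *: c i + be *: c j ->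
  a • (a • b) = (al / 4) *: b.
Proof.
move=> ij ik jk aP bP aE.
have ack : a • c k = 0 by rewrite jmulC (peirce_other _ _ aP) // eq_sym.
have := jordan_square A a (c k) b.
rewrite aE ack jmul0l scaler0 addr0 (peirce_r ik bP) (peirce_r jk (peirce_mul ij ik jk aP bP)).
rewrite jmulDl !jmulZl !orth // !scaler0 addr0 jmul0l.
rewrite jmulDl !jmulZl !jmulZr (peirce_l ik bP) (peirce_other _ jk bP) 1?eq_sym //.
move=> h; apply: (@dot_inj _ _ (jdot A)) => u.
have := congr1 (fun v => '[v, u]) h; rewrite /= !dotE; lra.
Qed.

(** The multiplication by a nonzero element of [V_ij] embeds [V_ik] in
    [V_jk]. *)
Lemma dim_peirce_le i j k : i != j -> i != k -> j != k ->
  peirce i j != 0%VS -> (\dim (peirce i k) <= \dim (peirce j k))%N.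
Proof.
move=> ij ik jk nz; have aP := memv_pick (peirce i j).
have a0 : vpick (peirce i j) != 0 by rewrite vpick0.
move: (vpick _) aP a0 => a aP a0.
have [al [be [aE al0]]] := peirce_square ij aP a0.
rewrite -(limg_dim_eq (f := mulop A a)); last first.
  apply/eqP; rewrite -subv0; apply/subvP => b; rewrite memv_cap memv_ker memv0 mulopE.
  move=> /andP[bP /eqP ab]; have := peirce_mulK ij ik jk aP bP aE.
  rewrite ab jmul0r => /esym/eqP; rewrite scaler_eq0 mulf_eq0 invr_eq0.
  by rewrite pnatr_eq0 gt_eqF.
apply: dimvS; apply/subvP => w /memv_imgP[b bP ->].
by rewrite mulopE (peirce_mul ij ik jk).
Qed.

Section Simple.
Context (Asimple : is_simple A).

(** Let [S] consist of [i] and of the [l] with [V_il != 0]. Then [V_lm = 0] for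
    [l] in [S] and [m] outside [S], so that [V] is the sum of [V_1(c_S)] and
    [V_0(c_S)], where [c_S] is the sum of the [c l], and [V_1(c_S)] is an
    ideal. It contains [c i], hence it is [V]. *)
Lemma simple_peirce_neq0 i j : i != j -> peirce i j != 0%VS.
Proof.
move=> ij; apply/negP => /eqP Pij.
pose S := [set l | (l == i) || (peirce i l != 0%VS)].
have iS : i \in S by rewrite inE eqxx.
have jS : j \notin S by rewrite inE Pij eqxx orbF eq_sym.
have mixed l m : l \in S -> m \notin S -> peirce l m = 0%VS.
  rewrite !inE negb_or negbK => lS /andP[mi /eqP Pim].
  have [->//|li] := eqVneq l i.
  have lm : l != m by apply: contraTneq lS => ->; rewrite Pim eqxx (negPf mi).
  rewrite (negPf li) /= in lS; apply/eqP; rewrite -dimv_eq0 -leqn0.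
  have <- : \dim (peirce i m) = 0%N by rewrite Pim dimv0.
  by apply: dim_peirce_le; rewrite // 1?peirceC // eq_sym.
set p := frame_part S.
have pp : idempotent_elt A p by exact: frame_part_idempotent.
have split y : p • (p • y) = p • y.
  have yE : y = p • y + \sum_(m in ~: S) c m • y.
    rewrite -jmul_suml -jmulDl -[LHS](jmul1l he) -frame_sum.
    rewrite (bigID (mem S)) /=; congr ((_ + _) • _).
    by apply: eq_bigl => m; rewrite finset.in_setC.
  rewrite {2}yE jmulDr jmul_sumr [X in _ + X]big1 ?addr0 // => m; rewrite finset.in_setC => mS.
  rewrite jmul_suml big1 // => l lS.
  have lm : l != m by apply: contraNneq mS => <-.
  by have := frame_peirce_offdiag y lm; rewrite mixed // memv0 => /eqP.
have ideal : is_ideal A (peirce1 A p).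
  move=> x y; rewrite !mem_peirce1 => /eqP py; rewrite (jmulC A x y).
  have -> : y • x = y • (p • x).
    apply/eqP; rewrite -subr_eq0 -jmulNr -jmulDr (peirce10_mul pp py) //.
    by rewrite jmulDr jmulNr split subrr.
  by rewrite (peirce1_mul pp).
have piE : c i \in peirce1 A p.
  by rewrite mem_peirce1 jmulC frame_mul_part iS scale1r.
case: (Asimple ideal) => h.
  by move: piE; rewrite h memv0 (negPf (frame_neq0 i)).
have : c j \in peirce1 A p by rewrite h memvf.
rewrite mem_peirce1 jmulC frame_mul_part (negPf jS) scale0r eq_sym.
by rewrite (negPf (frame_neq0 j)).
Qed.

Lemma dim_peirce_row i j k : i != j -> i != k -> \dim (peirce i j) = \dim (peirce i k).
Proof.
have le l m : i != l -> i != m -> (\dim (peirce i l) <= \dim (peirce i m))%N.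
  move=> il im; have [->//|lm] := eqVneq l m.
  rewrite (peirceC i l) (peirceC i m).
  have := @dim_peirce_le l m i lm; rewrite eq_sym => /(_ il).
  by rewrite eq_sym => /(_ im); apply; apply: simple_peirce_neq0.
by move=> ij ik; apply/eqP; rewrite eqn_leq !le.
Qed.

Lemma dim_peirce_offdiag : exists D, forall i j, i != j -> \dim (peirce i j) = D.
Proof.
have [[p p12]|nop] := pselect (exists p : 'I_r * 'I_r, p.1 != p.2); last first.
  by exists 0%N => i j ij; case: nop; exists (i, j).
exists (\dim (peirce p.1 p.2)) => i j ij.
have [ip2|ip2] := eqVneq i p.2; last first.
  by rewrite (@dim_peirce_row i j p.2) // peirceC (peirceC p.1);
     apply: dim_peirce_row; rewrite eq_sym // eq_sym.
rewrite ip2 (peirceC p.1); apply: dim_peirce_row; first by rewrite -ip2.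
by rewrite eq_sym.
Qed.

(** Among the pairs of indices of [J], [#|J|] are diagonal and
    [#|J| * (#|J| - 1) / 2] are increasing. *)
Lemma dim_peirce1_part : exists D : R, forall J,
  (\dim (peirce1 A (frame_part J)))%:R =
  #|J|%:R + D / 2 * (#|J|%:R * (#|J|%:R - 1)) :> R.
Proof.
have [D DP] := dim_peirce_offdiag; exists D%:R => J.
pose N (rel : nat -> nat -> bool) :=
  (\sum_(p : 'I_r * 'I_r | [&& p.1 \in J, p.2 \in J & rel p.1 p.2]) 1)%N.
have NE : (#|J| * #|J| = #|J| + N ltn + N ltn)%N.
  have swapN : N (fun s t : nat => t < s)%N = N ltn.
    rewrite /N (reindex_inj (h := fun p : 'I_r * 'I_r => (p.2, p.1))) /=; last first.
      by move=> [? ?] [? ?] [-> ->].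
    by apply: eq_bigl => p; rewrite andbCA.
  rewrite -{2}swapN -!sum1_card.
  rewrite big_distrlr /= pair_big /= (bigID (fun p => p.1 == p.2)) /= -addnA.
  congr (_ + _)%N.
    rewrite (reindex_onto (fun i => (i, i)) fst) /= => [|[i j] /= /andP[_ /eqP->]//].
    by apply: eq_bigl => i; rewrite !eqxx !andbT andbb.
  rewrite (bigID (fun p : 'I_r * 'I_r => p.1 < p.2)%N) /=; congr (_ + _)%N.
    apply: eq_bigl => p; rewrite -!andbA; congr [&& _, _ & _].
    by rewrite -val_eqE /=; case: ltngtP.
  apply: eq_bigl => p; rewrite -!andbA; congr [&& _, _ & _].
  by rewrite -val_eqE /=; case: ltngtP.
have -> : \dim (peirce1 A (frame_part J)) = (#|J| + N ltn * D)%N.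
  rewrite dim_peirce_part (bigID (fun p => p.1 == p.2)) /=; congr (_ + _)%N.
    rewrite -sum1_card (reindex_onto (fun i => (i, i)) fst) /=; last first.
      by move=> [i j] /= /andP[_ /eqP->].
    rewrite (eq_bigr (fun _ => 1%N)) => [|i _]; last exact: dim_peirce_diag.
    by apply: eq_bigl => i; rewrite !eqxx leqnn !andbT andbb.
  rewrite big_distrl /=; apply: eq_big => [p|p /andP[_ /DP->]]; last by rewrite mul1n.
  rewrite -!andbA; congr [&& _, _ & _].
  by rewrite -val_eqE /=; case: ltngtP.
have : #|J|%:R * #|J|%:R = #|J|%:R + (N ltn)%:R + (N ltn)%:R :> R.
  by rewrite -natrM NE !natrD.
rewrite natrD natrM; nra.
Qed.

End Simple.
End Peirce.

(** * Thompson's metric and the extreme eigenvalues *)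

Section Thompson.
Context (R : realType) (V : vectType R) (A : euclideanJordanAlgebra V).
Context (e : V) (he : is_unit A e) (e0 : e != 0).

Local Notation "x • y" := (jmul A x y) (at level 40, left associativity).
Local Notation "'[ u , v ]" := (jdot A u v) : ring_scope.
Local Notation cone := (cone_of_squares A).
Local Notation open_cone := (open_cone A).
Implicit Types (s t : R) (q u v w x y z : V).

Lemma open_cone_unit : open_cone e.
Proof.
apply: (open_cone_of_unit_le he ltr01).
by rewrite scale1r subrr; exact: cone0.
Qed.

Lemma open_cone_dot_gt0 x : open_cone x -> 0 < '[x, e].
Proof.
move=> /(open_cone_absorbing e)[t t0 /(cone_dot_ge0 he (unit_idempotent he))].
rewrite dotDl dotNl dotZl subr_ge0; apply: lt_le_trans.
by rewrite mulr_gt0 // dot_gt0.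
Qed.

(** The infimum in the gauge is attained, the cone being closed: it is
    defined by the linear inequalities [0 <= <y, q • q>]. *)
Lemma gauge_leP x y s : open_cone y -> 0 < s ->
  gauge A x y <= s <-> cone (s *: y - x).
Proof.
move=> yo s0; pose S := [set b : R | 0 < b /\ le_K A x (b *: y)]%classic.
have lbS : has_lbound S by exists 0 => b [/ltW].
split=> [gs|h]; last exact: ge_inf.
have S0 : (S !=set0)%classic.
  have [t t0 tK] := open_cone_absorbing x yo.
  exists t^-1; split; first by rewrite invr_gt0.
  rewrite /le_K -[x]scale1r -(mulVf (lt0r_neq0 t0)) -scalerA -scalerBr.
  by apply: (coneZ he) => //; rewrite invr_ge0 ltW.
have /(coneP he) yK := open_cone_cone yo.
apply/(coneP he) => q; rewrite dotDl dotNl dotZl subr_ge0 leNgt; apply/negP => h.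
have SP b : S b -> '[x, q • q] <= b * '[y, q • q].
  by move=> [_ /(coneP he)/(_ q)]; rewrite dotDl dotNl dotZl subr_ge0.
have : 0 <= '[y, q • q] by exact: yK.
rewrite le_eqVlt => /orP[/eqP Y0|Y0].
  case: S0 => b /SP; rewrite -Y0 !mulr0 in h *.
  by rewrite leNgt h.
have : gauge A x y < '[x, q • q] / '[y, q • q].
  by apply: le_lt_trans gs _; rewrite ltr_pdivlMr.
case/(inf_lt S0) => b /SP bS; rewrite ltr_pdivlMr // => b2.
by have := lt_le_trans b2 bS; rewrite ltxx.
Qed.

Definition max_gauge x y := Num.max (gauge A x y) (gauge A y x).

Lemma max_gauge_leP x y s : open_cone x -> open_cone y -> 0 < s ->
  max_gauge x y <= s <-> cone (s *: y - x) /\ cone (s *: x - y).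
Proof.
move=> xo yo s0; rewrite /max_gauge ge_max.
split=> [/andP[/(gauge_leP _ yo s0) h1 /(gauge_leP _ xo s0) h2]//|[h1 h2]].
by apply/andP; split; apply/gauge_leP.
Qed.

(** Composing [x <= s y] and [y <= s x] gives [x <= s^2 x]. *)
Lemma max_gauge_ge1 x y : open_cone x -> open_cone y -> 1 <= max_gauge x y.
Proof.
move=> xo yo; rewrite leNgt; apply/negP => m1.
have [s [s0 s1 ms]] : exists s, [/\ 0 < s, s < 1 & max_gauge x y <= s].
  by exists (Num.max 2^-1 (max_gauge x y)); rewrite lt_max gt_max le_max lexx orbT
    m1 invr_gt0 invf_lt1 ?ltr0n ?ltr1n.
have [h1 h2] := (max_gauge_leP xo yo s0).1 ms.
have := coneD he h1 (coneZ he (ltW s0) h2).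
rewrite scalerBr addrAC addrCA subrr addr0 scalerA => h.
have := cone_dot_ge0 he (unit_idempotent he) h.
have := open_cone_dot_gt0 xo; rewrite dotDl dotNl dotZl => xe.
have : s * s < 1 by rewrite -(mulr1 1) ltr_pM ?ltW.
nra.
Qed.

Lemma max_gauge_gt0 x y : open_cone x -> open_cone y -> 0 < max_gauge x y.
Proof. by move=> xo yo; apply: lt_le_trans ltr01 (max_gauge_ge1 xo yo). Qed.

Lemma max_gauge_triangle x z y : open_cone x -> open_cone y -> open_cone z ->
  max_gauge x y <= max_gauge x z * max_gauge z y.
Proof.
move=> xo yo zo; set s := max_gauge x z; set t := max_gauge z y.
have s0 : 0 < s by exact: max_gauge_gt0.
have t0 : 0 < t by exact: max_gauge_gt0.
have [h1 h2] := (max_gauge_leP xo zo s0).1 (lexx _).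
have [h3 h4] := (max_gauge_leP zo yo t0).1 (lexx _).
apply/max_gauge_leP; rewrite ?mulr_gt0 //; split.
  have := coneD he (coneZ he (ltW s0) h3) h1.
  by rewrite scalerBr scalerA addrA subrK.
have := coneD he (coneZ he (ltW t0) h2) h4.
by rewrite scalerBr scalerA addrA subrK mulrC.
Qed.

(** Two points at Thompson distance [ln m] have as midpoints the [z] with
    [d(x, z)] and [d(z, y)] at most [ln m / 2]: the triangle inequality
    forces equality. *)
Lemma midpointsP x z : open_cone x ->
  let s := Num.sqrt (max_gauge x e) in
  midpoints A x e z <->
  [/\ cone (s *: z - x), cone (s *: x - z), cone (s *: e - z) & cone (s *: z - e)].
Proof.
move=> xo s; have eo := open_cone_unit.
have m0 := max_gauge_gt0 xo eo.
have s0 : 0 < s by rewrite sqrtr_gt0.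
have ss : max_gauge x e = s * s by rewrite -expr2 sqr_sqrtr // ltW.
have half : thompson A x e / 2 = ln s.
  rewrite /thompson -/(max_gauge x e) ss lnM ?posrE //.
  by rewrite mulrDl -splitr.
rewrite /midpoints /= half; split=> [[zo h1 h2]|[h1 h2 h3 h4]].
  have e1 : max_gauge x z = s.
    by apply: ln_inj; rewrite ?posrE //; exact: max_gauge_gt0.
  have e2 : max_gauge z e = s.
    by apply: ln_inj; rewrite ?posrE //; exact: max_gauge_gt0.
  have /(max_gauge_leP xo zo s0)[? ?] : max_gauge x z <= s by rewrite e1.
  by have /(max_gauge_leP zo eo s0)[] : max_gauge z e <= s by rewrite e2.
have zo : open_cone z := open_cone_of_unit_le he s0 h4.
have g1 : max_gauge x z <= s by apply/max_gauge_leP.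
have g2 : max_gauge z e <= s by apply/max_gauge_leP.
have := max_gauge_triangle xo eo zo; rewrite ss => tri.
have xz0 := max_gauge_gt0 xo zo; have ze0 := max_gauge_gt0 zo eo.
split=> //; rewrite /thompson -/(max_gauge _ _); congr ln; apply/eqP; rewrite eq_le.
  rewrite g1 /= -(ler_pM2r s0); apply: le_trans tri _.
  by rewrite ler_pM2l.
rewrite g2 /= -(ler_pM2l s0); apply: le_trans tri _.
by rewrite ler_pM2r.
Qed.

End Thompson.

Section Spectrum.
Context (R : realType) (V : vectType R) (A : euclideanJordanAlgebra V).
Context (e : V) (he : is_unit A e) (e0 : e != 0).
Context (r : nat) (c : 'I_r -> V) (cframe : jordan_frame A e c).

Local Notation "x • y" := (jmul A x y) (at level 40, left associativity).
Local Notation "'[ u , v ]" := (jdot A u v) : ring_scope.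
Local Notation cone := (cone_of_squares A).
Local Notation open_cone := (open_cone A).
Implicit Types (s t : R) (q u v w x y z : V) (lam : 'I_r -> R) (i : 'I_r).

Lemma frame_dot lam i : '[\sum_j lam j *: c j, c i] = lam i * '[c i, c i].
Proof.
apply: dot_sum_orthogonal; first exact: frame_idempotent cframe.
by move=> j k; exact: (frame_orthogonal cframe).
Qed.

Lemma cone_frameP lam : cone (\sum_i lam i *: c i) <-> forall i, 0 <= lam i.
Proof.
split=> [h i|]; last exact/cone_sum/frame_idempotent/cframe.
have := cone_dot_ge0 he (frame_idempotent cframe i) h.
by rewrite frame_dot pmulr_lge0 // (frame_dot_gt0 cframe).
Qed.

Lemma open_cone_frame_gt0 lam i : open_cone (\sum_i lam i *: c i) -> 0 < lam i.
Proof.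
move=> /(open_cone_absorbing (c i))[t t0 h].
have := cone_dot_ge0 he (frame_idempotent cframe i) h.
have ci := frame_dot_gt0 cframe i.
rewrite dotDl dotNl frame_dot dotZl -mulrBl pmulr_lge0 // subr_ge0.
exact: lt_le_trans.
Qed.

Lemma frame_unitZ s : s *: e = \sum_i s *: c i.
Proof. by rewrite -(frame_sum cframe) scaler_sumr. Qed.

End Spectrum.

Section Extremal.
Context (R : realType) (V : vectType R) (A : euclideanJordanAlgebra V).
Context (e : V) (he : is_unit A e).
Context (r : nat) (lam : 'I_r -> R) (x : V) (xlam : eigenvalues A e x lam).

(** An upper bound of the eigenvalues in one frame is expressed by
    [x <= s e], which does not mention the frame; so it bounds the eigenvalues
    in any other frame. *)
Lemma spectrum_le s : (forall i, lam i <= s) -> forall a, spectrum A e x a -> a <= s.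
Proof.
move=> lams a [r' [lam' [[c' c'f xE'] [i ->]]]].
case: xlam => c cf xE.
have : cone_of_squares A (s *: e - x).
  rewrite xE (frame_unitZ cf) -sumrB.
  under eq_bigr do rewrite -scalerBl.
  by apply/(cone_frameP he cf) => j; rewrite subr_ge0.
rewrite xE' (frame_unitZ c'f) -sumrB.
under eq_bigr do rewrite -scalerBl.
by move/(cone_frameP he c'f)/(_ i); rewrite subr_ge0.
Qed.

Lemma spectrum_ge s : (forall i, s <= lam i) -> forall a, spectrum A e x a -> s <= a.
Proof.
move=> lams a [r' [lam' [[c' c'f xE'] [i ->]]]].
case: xlam => c cf xE.
have : cone_of_squares A (x - s *: e).
  rewrite xE (frame_unitZ cf) -sumrB.
  under eq_bigr do rewrite -scalerBl.
  by apply/(cone_frameP he cf) => j; rewrite subr_ge0.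
rewrite xE' (frame_unitZ c'f) -sumrB.
under eq_bigr do rewrite -scalerBl.
by move/(cone_frameP he c'f)/(_ i); rewrite subr_ge0.
Qed.

Lemma mem_spectrum i : spectrum A e x (lam i).
Proof. by exists r, lam; split=> //; exists i. Qed.

Lemma lambda_max_spec (i0 : 'I_r) :
  (forall i, lam i <= lambda_max A e x) /\ exists i, lambda_max A e x = lam i.
Proof.
have [im _ imP] := arg_maxP lam (erefl true : predT i0).
have ub := spectrum_le (fun i => imP i isT).
have E : lambda_max A e x = lam im.
  apply/eqP; rewrite eq_le ub_le_sup ?ge_sup //; first by exists (lam im); exact: mem_spectrum.
  - by exists (lam im).
  - exact: mem_spectrum.
by split; [move=> i; rewrite E; exact: imP | exists im].
Qed.

Lemma lambda_min_spec (i0 : 'I_r) :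
  (forall i, lambda_min A e x <= lam i) /\ exists i, lambda_min A e x = lam i.
Proof.
have [im _ imP] := arg_minP lam (erefl true : predT i0).
have lb := spectrum_ge (fun i => imP i isT).
have E : lambda_min A e x = lam im.
  apply/eqP; rewrite eq_le ge_inf ?lb_le_inf //; first by exists (lam im); exact: mem_spectrum.
  - by exists (lam im).
  - exact: mem_spectrum.
by split; [move=> i; rewrite E; exact: imP | exists im].
Qed.

Lemma max_gauge_eigenvalues (i0 : 'I_r) : e != 0 -> open_cone A x ->
  max_gauge A x e = Num.max (lambda_max A e x) (lambda_min A e x)^-1.
Proof.
move=> e0 xo; have eo := open_cone_unit he.
have m0 := max_gauge_gt0 he e0 xo eo.
have [maxP [imax maxE]] := lambda_max_spec i0.
have [minP [imin minE]] := lambda_min_spec i0.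
case: xlam => c cf xE.
have lam0 i : 0 < lam i by move: xo; rewrite xE; exact: open_cone_frame_gt0.
have leP s : 0 < s -> max_gauge A x e <= s <-> forall i, lam i <= s /\ (lam i)^-1 <= s.
  move=> s0; rewrite max_gauge_leP // (frame_unitZ cf) -[e]scale1r (frame_unitZ cf) xE.
  rewrite scaler_sumr -!sumrB.
  under eq_bigr do rewrite -scalerBl.
  under [X in _ /\ cone_of_squares _ X]eq_bigr do rewrite scalerA -scalerBl.
  rewrite !(cone_frameP he cf); split=> [[h1 h2] i|h].
    by have := h1 i; have := h2 i; rewrite !subr_ge0 -ler_pdivrMr // div1r.
  by split=> i; have [] := h i; rewrite subr_ge0 // -[_^-1]div1r ler_pdivrMr.
have M0 : 0 < Num.max (lambda_max A e x) (lambda_min A e x)^-1.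
  by rewrite lt_max maxE lam0.
apply/eqP; rewrite eq_le; apply/andP; split.
  apply/(leP _ M0) => i; rewrite !le_max maxP; split=> //.
  by rewrite lef_pV2 ?posrE ?lam0 ?minP ?orbT // minE lam0.
have /(leP _ m0) h : max_gauge A x e <= max_gauge A x e by [].
by rewrite ge_max maxE minE (h imax).1 (h imin).2.
Qed.

End Extremal.

(** * The set of midpoints *)

Section MidpointSet.
Context (R : realType) (V : vectType R) (A : euclideanJordanAlgebra V).
Context (e : V) (he : is_unit A e) (e0 : e != 0).
Context (r : nat) (c : 'I_r -> V) (cframe : jordan_frame A e c).
Context (lam : 'I_r -> R) (xo : open_cone A (\sum_i lam i *: c i)).

Local Notation x := (\sum_i lam i *: c i).
Local Notation "x • y" := (jmul A x y) (at level 40, left associativity).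
Local Notation "'[ u , v ]" := (jdot A u v) : ring_scope.
Local Notation cone := (cone_of_squares A).
Implicit Types (s t : R) (q u v w y z : V) (i : 'I_r) (J : {set 'I_r}).

(** By [peirce1_order_unit] the perturbation by a small multiple of [w] is
    absorbed by the part of the sum over [J]. *)
Lemma cone_frame_perturb J (gam : 'I_r -> R) w :
  (forall i, 0 <= gam i) -> (forall i, i \in J -> 0 < gam i) ->
  frame_part c J • w = w ->
  exists2 del : R, 0 < del &
    forall t, `|t| <= del -> cone (\sum_i gam i *: c i + t *: w).
Proof.
move=> gam0 gamJ wJ.
have [B B0 BP] := peirce1_order_unit he (frame_part_idempotent cframe J) wJ.
pose be := \big[Num.min/1]_(i in J) gam i.
have be0 : 0 < be by apply: lt_bigmin => //; exact: ltr01.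
have B1 : 0 < B + 1 by rewrite ltr_wpDl.
exists (be / (B + 1)) => [|t]; first by rewrite divr_gt0.
rewrite ler_pdivlMr // => tB; apply/(coneP he) => q.
have cq i : 0 <= '[c i, q • q].
  exact: (dot_idempotent_square_ge0 _ (frame_idempotent cframe i)).
have p0 : 0 <= '[frame_part c J, q • q].
  exact: (dot_idempotent_square_ge0 _ (frame_part_idempotent cframe J)).
have h1 : be * '[frame_part c J, q • q] <= '[\sum_i gam i *: c i, q • q].
  rewrite !dot_suml mulr_sumr [leRHS](bigID (mem J)) /= ler_wpDr //.
    by apply: sumr_ge0 => i _; rewrite dotZl mulr_ge0.
  by apply: ler_sum => i iJ; rewrite dotZl ler_wpM2r // bigmin_le_cond.
have h2 : - (`|t| * (B * '[frame_part c J, q • q])) <= t * '[w, q • q].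
  rewrite lerNl; apply: le_trans (ler_norm _) _.
  by rewrite normrN normrM ler_wpM2l.
rewrite dotDl dotZl; move: (BP q) h1 h2 p0.
move: ('[frame_part c J, _]) => E _ h1 h2 E0.
have : 0 <= (be - `|t| * (B + 1)) * E by rewrite mulr_ge0 // subr_ge0.
have : 0 <= `|t| * E by rewrite mulr_ge0.
lra.
Qed.

Let m := max_gauge A x e.
Let s : R := Num.sqrt m.
Let a i : R := Num.sqrt (lam i).
Let J := [set i | Num.max (lam i) (lam i)^-1 != m].
(** This is the square root of [x], the geometric midpoint of [x] and [e]. *)
Let z0 := \sum_i a i *: c i.

Lemma eigenvalue_gt0 i : 0 < lam i.
Proof. exact: (open_cone_frame_gt0 he cframe _ xo). Qed.

Lemma sqrt_eigenvalue i : 0 < a i /\ lam i = a i * a i.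
Proof.
by rewrite sqrtr_gt0 -expr2 sqr_sqrtr ?eigenvalue_gt0 // ltW // eigenvalue_gt0.
Qed.

Lemma sqrt_max_gauge : 0 < s /\ m = s * s.
Proof.
have m0 : 0 < m := max_gauge_gt0 he e0 xo (open_cone_unit he).
by rewrite sqrtr_gt0 -expr2 sqr_sqrtr // ltW.
Qed.

Lemma max_eigenvalue_le i : Num.max (lam i) (lam i)^-1 <= m.
Proof.
have eo := open_cone_unit he; have m0 : 0 < m := max_gauge_gt0 he e0 xo eo.
have [] := (max_gauge_leP he xo eo m0).1 (lexx _).
rewrite (frame_unitZ cframe) -[e]scale1r (frame_unitZ cframe) scaler_sumr -!sumrB.
under eq_bigr do rewrite -scalerBl.
move=> /(cone_frameP he cframe)/(_ i); rewrite subr_ge0 => h1.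
under eq_bigr do rewrite scalerA -scalerBl.
move=> /(cone_frameP he cframe)/(_ i); rewrite subr_ge0 => h2.
by rewrite ge_max h1 -div1r ler_pdivrMr ?eigenvalue_gt0.
Qed.

Lemma sqrt_bounds i : a i <= s /\ 1 <= s * a i.
Proof.
have [ai0 aE] := sqrt_eigenvalue i; have [s0 sE] := sqrt_max_gauge.
have := max_eigenvalue_le i; rewrite ge_max => /andP[h1 h2]; split.
  by rewrite /a /s ler_sqrt // sE mulr_ge0 // ltW.
rewrite -div1r ler_pdivrMr ?eigenvalue_gt0 // sE aE in h2.
have sa0 : 0 < s * a i by rewrite mulr_gt0.
rewrite leNgt; apply/negP => h; have : s * a i * (s * a i) < 1 * 1.
  by rewrite ltr_pM // ltW.
lra.
Qed.

Lemma sqrt_bounds_lt i : i \in J -> a i < s /\ 1 < s * a i.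
Proof.
have [ai0 aE] := sqrt_eigenvalue i; have [s0 sE] := sqrt_max_gauge.
have [b1 b2] := sqrt_bounds i; have := max_eigenvalue_le i.
rewrite inE ge_max => /andP[h1 h2] neq; rewrite !lt_neqAle b1 b2 !andbT.
split; apply: contraNneq neq => E.
  by apply/eqP/le_anti; rewrite ge_max h1 h2 le_max aE E sE lexx.
have mE : m = (lam i)^-1.
  apply: (mulIf (lt0r_neq0 (eigenvalue_gt0 i))); rewrite mulVf ?lt0r_neq0 ?eigenvalue_gt0 //.
  by rewrite sE aE mulrACA -E mulr1.
by apply/eqP/le_anti; rewrite ge_max h1 h2 le_max mE lexx orbT.
Qed.

Lemma sqrt_bounds_eq i : i \notin J -> a i = s \/ 1 = s * a i.
Proof.
have [ai0 aE] := sqrt_eigenvalue i; have [s0 sE] := sqrt_max_gauge.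
rewrite inE negbK /Num.max; case: ifP => _ /eqP E; [right|left].
  have h : s * a i * (s * a i) = 1.
    by rewrite mulrACA -sE -aE -E mulVf // lt0r_neq0 ?eigenvalue_gt0.
  by apply/eqP; rewrite eq_sym -sqrp_eq1 ?expr2 ?h // ltW ?mulr_gt0.
by rewrite /a /s E.
Qed.

Lemma midpoint_direction w : frame_part c J • w = w ->
  exists2 eps : R, 0 < eps & midpoints A x e (z0 + eps *: w).
Proof.
move=> wJ; have [s0 sE] := sqrt_max_gauge.
have P gam : (forall i, 0 <= gam i) -> (forall i, i \in J -> 0 < gam i) ->
    exists2 del : R, 0 < del & forall t, `|t| <= del -> cone (\sum_i gam i *: c i + t *: w).
  by move=> *; apply: cone_frame_perturb wJ.
have [||d1 d1_gt0 D1] := P (fun i => s * a i - lam i).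
- move=> i; have [ai0 ->] := sqrt_eigenvalue i; have [h _] := sqrt_bounds i.
  by rewrite -mulrBl mulr_ge0 ?subr_ge0 // ltW.
- move=> i iJ; have [ai0 ->] := sqrt_eigenvalue i; have [h _] := sqrt_bounds_lt iJ.
  by rewrite -mulrBl mulr_gt0 ?subr_gt0.
have [||d2 d2_gt0 D2] := P (fun i => s * lam i - a i).
- move=> i; have [ai0 ->] := sqrt_eigenvalue i; have [_ h] := sqrt_bounds i.
  by rewrite mulrA -[X in _ - X]mul1r -mulrBl mulr_ge0 ?subr_ge0 // ltW.
- move=> i iJ; have [ai0 ->] := sqrt_eigenvalue i; have [_ h] := sqrt_bounds_lt iJ.
  by rewrite mulrA -[X in _ - X]mul1r -mulrBl mulr_gt0 ?subr_gt0.
have [||d3 d3_gt0 D3] := P (fun i => s - a i).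
- by move=> i; have [h _] := sqrt_bounds i; rewrite subr_ge0.
- by move=> i iJ; have [h _] := sqrt_bounds_lt iJ; rewrite subr_gt0.
have [||d4 d4_gt0 D4] := P (fun i => s * a i - 1).
- by move=> i; have [_ h] := sqrt_bounds i; rewrite subr_ge0.
- by move=> i iJ; have [_ h] := sqrt_bounds_lt iJ; rewrite subr_gt0.
pose eps := Num.min (Num.min (d1 / s) (d4 / s)) (Num.min d2 d3).
have eps0 : 0 < eps by rewrite !lt_min !divr_gt0 ?d2_gt0.
have : eps <= eps by [].
rewrite {2}/eps !le_min !ler_pdivlMr // => /andP[/andP[e1 e4] /andP[e2 e3]].
have ns : `|s * eps| = eps * s by rewrite ger0_norm ?mulr_ge0 ?ltW // mulrC.
have nn : `|- eps| = eps by rewrite normrN ger0_norm // ltW.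
exists eps => //; apply/(midpointsP he e0 _ xo); rewrite -/m -/s; split.
- have := D1 (s * eps); rewrite ns => /(_ e1); congr (cone _).
  under eq_bigr do rewrite scalerBl -scalerA.
  by rewrite sumrB -scaler_sumr -/z0 scalerDr scalerA addrAC.
- have := D2 (- eps); rewrite nn => /(_ e2); congr (cone _).
  under eq_bigr do rewrite scalerBl -scalerA.
  by rewrite sumrB -scaler_sumr -/z0 opprD addrA scaleNr.
- have := D3 (- eps); rewrite nn => /(_ e3); congr (cone _).
  under eq_bigr do rewrite scalerBl.
  by rewrite sumrB -(frame_unitZ cframe) -/z0 opprD addrA scaleNr.
have := D4 (s * eps); rewrite ns => /(_ e4); congr (cone _).
under eq_bigr do rewrite scalerBl -scalerA.
rewrite sumrB -scaler_sumr -(frame_unitZ cframe) -/z0 scale1r scalerDr scalerA.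
by rewrite addrAC.
Qed.

(** For [i] outside [J] two of the four inequalities of [midpointsP] become
    equalities after taking the inner product with [c i]. *)
Lemma midpoint_sub z : midpoints A x e z -> frame_part c J • (z - z0) = z - z0.
Proof.
move=> /(midpointsP he e0 _ xo); rewrite -/m -/s => -[h1 h2 h3 h4].
have [s0 sE] := sqrt_max_gauge.
have ze i : '[e, c i] = '[c i, c i].
  by rewrite -{1}(frame_idempotent cframe i) -jdot_jmul jmulC jmul1l.
have fixed i : i \notin J -> c i • (z - z0) = 0.
  move=> iJ; have ci := frame_dot_gt0 cframe i.
  have [ai0 aE] := sqrt_eigenvalue i; have idem := frame_idempotent cframe i.
  have -> : c i • (z - z0) = c i • z - a i *: c i.
    by rewrite jmulDr jmulNr /z0 (frame_mul_sum cframe predT).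
  have ge0 y : cone y -> 0 <= '[y, c i] := cone_dot_ge0 he idem.
  have le0 y : cone y -> '[y, c i] <= 0 -> c i • y = 0 := cone_dot_le0 he idem.
  case: (sqrt_bounds_eq iJ) => E.
    have g1 := ge0 _ h1; rewrite dotDl dotNl dotZl (frame_dot cframe) aE E in g1.
    have /(le0 _ h3) : '[s *: e - z, c i] <= 0.
      rewrite dotDl dotNl dotZl ze subr_le0 -(ler_pM2l s0) mulrA.
      by rewrite -subr_ge0.
    rewrite jmulDr jmulNr jmulZr (jmul1r he) E => /eqP.
    by rewrite subr_eq0 => /eqP <-; rewrite subrr.
  have g2 := ge0 _ h2; rewrite dotDl dotNl dotZl (frame_dot cframe) aE in g2.
  have /(le0 _ h4) : '[s *: z - e, c i] <= 0.
    rewrite dotDl dotNl dotZl ze subr_le0.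
    rewrite mulrA (mulrA s) -E mul1r subr_ge0 in g2.
    by have := g2; rewrite -(ler_pM2l s0) mulrA -E mul1r.
  rewrite jmulDr jmulNr jmulZr (jmul1r he) => /eqP; rewrite subr_eq0 => /eqP h.
  have -> : c i • z = a i *: (s *: (c i • z)) by rewrite scalerA mulrC -E scale1r.
  by rewrite h subrr.
rewrite -[RHS](jmul1l he) -(frame_sum cframe) /frame_part !jmul_suml [RHS](bigID (mem J)) /=.
by rewrite [X in _ = _ + X]big1 ?addr0.
Qed.

(** For [w] in [V_1(c_J)] and [t > 0] small, [z0 + w] is the affine combination
    [(1 - 1 / t) z0 + (1 / t) (z0 + t w)] of two midpoints. *)
Lemma affine_span_midpoints :
  affine_span (midpoints A x e) = [set y | y - z0 \in peirce1 A (frame_part c J)]%classic.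
Proof.
apply/seteqP; split=> [y [k [p [t [pM t1 ->]]]]|y] /=.
  have -> : \sum_(i < k) t i *: p i - z0 = \sum_(i < k) t i *: (p i - z0).
    rewrite -[X in _ - X]scale1r -t1 scaler_suml -sumrB.
    by apply: eq_bigr => i _; rewrite scalerBr.
  apply: memv_suml => i _; apply: memvZ; rewrite mem_peirce1.
  by apply/eqP/midpoint_sub.
rewrite mem_peirce1 => /eqP /midpoint_direction[eps eps0 h].
have [d _ z0M] : exists2 d : R, 0 < d & midpoints A x e (z0 + d *: 0).
  by apply: midpoint_direction; rewrite jmul0r.
rewrite scaler0 addr0 in z0M.
exists 2%N, (fun i : 'I_2 => if i == 0 :> nat then z0 else z0 + eps *: (y - z0)).
exists (fun i : 'I_2 => if i == 0 :> nat then 1 - eps^-1 else eps^-1).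
split=> [i||]; first by case: ifP.
  by rewrite !big_ord_recl big_ord0 /= addr0 subrK.
rewrite !big_ord_recl big_ord0 /= addr0 scalerDr addrA -scalerDl subrK scale1r.
by rewrite scalerA mulVf ?gt_eqF // scale1r addrC subrK.
Qed.

End MidpointSet.

Theorem corollary4p4 (R : realType) (V : vectType R)
  (A : euclideanJordanAlgebra V) (e : V) (n r : nat)
  (he : is_unit A e) (hsimple : is_simple A)
  (hn : \dim (fullv : {vspace V}) = n)
  (hr : has_rank A e r) (hr1 : (1 < r)%N)
  (x : V) (hx : open_cone A x)
  (lam : 'I_r -> R) (hlam : eigenvalues A e x lam)
  (k : nat)
  (hk : k = #|[set i : 'I_r | Num.max (lam i) (lam i)^-1
                 != Num.max (lambda_max A e x) (lambda_min A e x)^-1]|) :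
  exists d : nat,
    has_affine_dim (affine_span (midpoints A x e)) d /\
    d%:R = k%:R + (n%:R - r%:R) / (r%:R * (r%:R - 1)) * (k%:R * (k%:R - 1)) :> R.
Proof.
have i0 : 'I_r := Ordinal (ltnW hr1).
have [c cframe xE] := hlam.
have e0 : e != 0.
  have := frame_neq0 cframe i0; apply: contraNneq => h.
  by rewrite -(jmul1l he (c i0)) h jmul0l.
rewrite -(max_gauge_eigenvalues he hlam i0 e0 hx) in hk.
have [D DP] := dim_peirce1_part he cframe hsimple.
have nE : n%:R = r%:R + D / 2 * (r%:R * (r%:R - 1)) :> R.
  have := DP [set: 'I_r]; rewrite (frame_partT cframe) cardsT card_ord => <-.
  congr (_%:R); rewrite -hn; congr (\dim _); apply/vspaceP => v.
  by rewrite memvf mem_peirce1 (jmul1l he) eqxx.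
subst x.
exists (\dim (peirce1 A (frame_part c
  [set i | Num.max (lam i) (lam i)^-1 != max_gauge A (\sum_i lam i *: c i) e]))).
split.
  exists (\sum_i Num.sqrt (lam i) *: c i); eexists; split; last by [].
  exact: (affine_span_midpoints he e0 cframe hx).
rewrite DP -hk nE addrAC subrr add0r mulfK //.
rewrite mulf_neq0 // ?subr_eq0 ?pnatr_eq0 -?lt0n ?(ltnW hr1) //.
by rewrite (eqr_nat R r 1) gtn_eqF.
Qed.
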